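(* Let $G$ be a group and $N$ a normal subgroup. For every $c\in\mathcal{C}_{\mathbb{Q}}(G,N)$, $4\,\mathrm{scl}_{G,N}(c)=\mathrm{fl}_{G,N}(c)$.
   Context: Chains: $\mathrm{C}_1(G;A)$ is the free $A$-module on $G$, $\mathrm{C}_2(G;A)$ the free $A$-module on $G\times G$, $\partial(g_1,g_2)=g_2-g_1g_2+g_1$. $\mathrm{C}'_2(G,N;A)$ is generated by pairs $(g_1,g_2)$ with $g_1\in N$ or $g_2\in N$; $\mathrm{B}'_1(G,N;A)=\partial\,\mathrm{C}'_2(G,N;A)$; $\mathcal{C}_A(G,N)=\mathrm{C}_1(N;A)\cap\mathrm{B}'_1(G,N;A)$. For $c\in\mathrm{B}'_1(G,N;\mathbb{R})$, $\|c\|'=\inf\{\|c'\|_1: c'\in\mathrm{C}'_2(G,N;\mathbb{R}),\ \partial c'=c\}$ where $\|\cdot\|_1$ is the $\ell^1$-norm with respect to the basis $G\times G$. Filling norm: for $c=x_1+\cdots+x_k-\check x_1-\cdots-\check x_l\in\mathcal{C}_{\mathbb{Z}}(G,N)$ ($x_i,\check x_j\in N$), $\mathrm{fl}_{G,N}(c)=\lim_{n\to\infty}\frac1n\|x_1^n+\cdots+x_k^n-\check x_1^n-\cdots-\check x_l^n\|'$; for rational $c$, $\mathrm{fl}_{G,N}(c)=\frac1m\mathrm{fl}_{G,N}(mc)$ with $mc$ integral. Mixed scl: $[G,N]$ is generated by $[g,x]=gxg^{-1}x^{-1}$ ($g\in G,x\in N$), $\mathrm{cl}_{G,N}$ the word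 length with respect to these generators. For $x_1,\dots,x_m\in N$ with $x_1\cdots x_m\in[G,N]$: $\mathrm{cl}_{G,N}(x_1+\cdots+x_m)=\inf_{g_i\in G}\mathrm{cl}_{G,N}(x_1g_1x_2g_1^{-1}\cdots g_{m-1}x_mg_{m-1}^{-1})$, $\mathrm{scl}_{G,N}(x_1+\cdots+x_m)=\lim_n\frac1n\mathrm{cl}_{G,N}(x_1^n+\cdots+x_m^n)$. For $c=x_1+\cdots+x_k-\check x_1-\cdots-\check x_l\in\mathcal{C}_{\mathbb{Z}}(G,N)$ (with $x_1\cdots x_k\check x_1^{-1}\cdots\check x_l^{-1}\in[G,N]$), $\mathrm{scl}_{G,N}(c)=\mathrm{scl}_{G,N}(x_1+\cdots+x_k+\check x_1^{-1}+\cdots+\check x_l^{-1})$; for rational $c$, $\mathrm{scl}_{G,N}(c)=\frac1m\mathrm{scl}_{G,N}(mc)$. *)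

(* Defs.v *)
From Stdlib Require Import Reals List QArith Qreals ClassicalDescription.
From Coquelicot Require Import Coquelicot.
Import ListNotations.
Open Scope R_scope.

Record Group := {
  carrier :> Type;
  gmul : carrier -> carrier -> carrier;
  gone : carrier;
  ginv : carrier -> carrier;
  gmul_assoc : forall a b c, gmul a (gmul b c) = gmul (gmul a b) c;
  gmul_1l : forall a, gmul gone a = a;
  gmul_1r : forall a, gmul a gone = a;
  gmul_Vl : forall a, gmul (ginv a) a = gone;
  gmul_Vr : forall a, gmul a (ginv a) = gone
}.
Arguments gmul {_}. Arguments gone {_}. Arguments ginv {_}.

Record normal_subgroup (G : Group) (N : G -> Prop) : Prop := {
  ns_one : N gone;
  ns_mul : forall x y, N x -> N y -> N (gmul x y);
  ns_inv : forall x, N x -> N (ginv x);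
  ns_conj : forall g x, N x -> N (gmul (gmul g x) (ginv g))
}.

Fixpoint gpow {G : Group} (x : G) (n : nat) : G :=
  match n with O => gone | S k => gmul x (gpow x k) end.

Definition comm {G : Group} (g x : G) : G :=
  gmul (gmul (gmul g x) (ginv g)) (ginv x).

(* Chains with real coefficients; coefficient rings Z, Q, R are seen   *)
(* as subsets of R.                                                    *)
Definition is_int (r : R) : Prop := exists z : Z, r = IZR z.
Definition is_rat (r : R) : Prop := exists q : Q, r = Q2R q.

Definition chain1 (G : Group) := G -> R.

Definition delta {G : Group} (g h : G) : R :=
  if excluded_middle_informative (g = h) then 1 else 0.

Definition formal1 {G : Group} (L : list (R * G)) : chain1 G :=
  fun h => fold_right (fun p acc => fst p * delta (snd p) h + acc) 0 L.

(* A 2-chain is given by a finite list of (coefficient, (g1,g2)); when  *)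
(* the pairs are distinct this is exactly an element of C_2 with finite *)
(* support, and l1 below is its l^1 norm.                              *)
Definition bd2 {G : Group} (L : list (R * (G * G))) : chain1 G :=
  fun h => fold_right (fun p acc =>
     fst p * (delta (snd (snd p)) h - delta (gmul (fst (snd p)) (snd (snd p))) h
              + delta (fst (snd p)) h) + acc) 0 L.

Definition l1 {G : Group} (L : list (R * (G * G))) : R :=
  fold_right (fun p acc => Rabs (fst p) + acc) 0 L.

Definition in_C2' {G : Group} (N : G -> Prop) (L : list (R * (G * G))) : Prop :=
  List.Forall (fun p => N (fst (snd p)) \/ N (snd (snd p))) L.

Definition in_B1' {G : Group} (A : R -> Prop) (N : G -> Prop) (c : chain1 G) : Prop :=
  exists L : list (R * (G * G))%type,
    List.Forall (fun p => A (fst p)) L /\ in_C2' N L /\ (forall h, bd2 L h = c h).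

Definition in_C1N {G : Group} (A : R -> Prop) (N : G -> Prop) (c : chain1 G) : Prop :=
  exists L : list (R * G)%type,
    List.Forall (fun p => A (fst p) /\ N (snd p)) L /\ (forall h, formal1 L h = c h).

Definition in_CC {G : Group} (A : R -> Prop) (N : G -> Prop) (c : chain1 G) : Prop :=
  in_C1N A N c /\ in_B1' A N c.

Definition normp {G : Group} (N : G -> Prop) (c : chain1 G) : R :=
  real (Glb_Rbar (fun r => exists L : list (R * (G * G))%type,
      NoDup (map snd L) /\ in_C2' N L /\ (forall h, bd2 L h = c h) /\ r = l1 L)).

Definition int_chain {G : Group} (xs xcs : list G) : chain1 G :=
  formal1 (map (fun x => (1, x)) xs ++ map (fun x => (-1, x)) xcs).

Definition fl_seq {G : Group} (N : G -> Prop) (xs xcs : list G) (n : nat) : R :=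
  normp N (int_chain (map (fun x => gpow x (S n)) xs) (map (fun x => gpow x (S n)) xcs))
  / INR (S n).

Definition fl_int {G : Group} (N : G -> Prop) (xs xcs : list G) : R :=
  real (Lim_seq (fl_seq N xs xcs)).

Definition gprod {G : Group} (l : list G) : G := fold_right gmul gone l.

Definition is_prod_gens {G : Group} (N : G -> Prop) (w : G) (k : nat) : Prop :=
  exists l : list (G * G * bool)%type,
    length l = k /\ List.Forall (fun t => N (snd (fst t))) l /\
    w = gprod (map (fun t : (G * G * bool)%type => if snd t then comm (fst (fst t)) (snd (fst t))
                             else ginv (comm (fst (fst t)) (snd (fst t)))) l).

Definition cl {G : Group} (N : G -> Prop) (w : G) : R :=
  real (Glb_Rbar (fun r => exists k, is_prod_gens N w k /\ r = INR k)).

Fixpoint conj_tail {G : Group} (gs xs : list G) : G :=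
  match gs, xs with
  | g :: gs', x :: xs' => gmul (gmul (gmul g x) (ginv g)) (conj_tail gs' xs')
  | _, _ => gone
  end.

Definition conj_word {G : Group} (xs gs : list G) : G :=
  match xs with [] => gone | x1 :: rest => gmul x1 (conj_tail gs rest) end.

Definition cl_chain {G : Group} (N : G -> Prop) (xs : list G) : R :=
  real (Glb_Rbar (fun r => exists gs : list G,
      length gs = pred (length xs) /\ r = cl N (conj_word xs gs))).

(* scl_{G,N}(x_1+..+x_k - xc_1 - .. - xc_l)
   = scl_{G,N}(x_1+..+x_k + xc_1^-1 + .. + xc_l^-1) *)
Definition scl_seq {G : Group} (N : G -> Prop) (xs xcs : list G) (n : nat) : R :=
  cl_chain N (map (fun y => gpow y (S n)) (xs ++ map ginv xcs)) / INR (S n).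

Definition scl_int {G : Group} (N : G -> Prop) (xs xcs : list G) : R :=
  real (Lim_seq (scl_seq N xs xcs)).

(* Main.v *)
(* The inequality [fl <= 4 scl] holds because [g,x] has a filling by 3 triangles, so that a
   product of K mixed commutators has one of norm at most 4K + 1.

   For the converse, Dirichlet's simultaneous approximation turns a real filling of an integral
   chain into an integral filling, of almost proportional norm, of a multiple of the chain.
   Its triangles are glued along their edges to a surface whose boundary spells the chain.
   An Euler characteristic count bounds the genus by a quarter of the number of triangles, up to
   an error linear in the number of boundary edges, and the genus bounds the number of
   commutators. Mixedness is preserved by gluing edges outside N first: every boundary word then
   has value in N and contains zero or two letters outside N. Applied to the n-th powers, the
   error is negligible as n grows.

   Fekete's lemma gives the limit defining scl, and both inequalities, holding for each n up to a
   constant, then force the limit defining fl to exist. *)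

Require Import Defs.
From Stdlib Require Import Reals List ZArith QArith Qreals Permutation Lia Lra.
From Stdlib Require Import Classical ClassicalDescription.
From Coquelicot Require Import Coquelicot.
Import List ListNotations.
Open Scope R_scope.

Arguments gmul_assoc {_}. Arguments gmul_1l {_}. Arguments gmul_1r {_}.
Arguments gmul_Vl {_}. Arguments gmul_Vr {_}.

Declare Scope grp_scope.
Delimit Scope grp_scope with grp.
Infix "*" := gmul : grp_scope.

(** * Identities in groups *)

Lemma mulVK {G : Group} (a b : G) : (ginv a * (a * b))%grp = b.
Proof. now rewrite gmul_assoc, gmul_Vl, gmul_1l. Qed.

Lemma mulKV {G : Group} (a b : G) : (a * (ginv a * b))%grp = b.
Proof. now rewrite gmul_assoc, gmul_Vr, gmul_1l. Qed.

Lemma inv_unique {G : Group} (a b : G) : (a * b)%grp = gone -> b = ginv a.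
Proof. intros H. rewrite <- (mulVK a b), H. apply gmul_1r. Qed.

Lemma inv_one {G : Group} : ginv gone = gone :> G.
Proof. symmetry. apply inv_unique, gmul_1l. Qed.

Lemma inv_inv {G : Group} (a : G) : ginv (ginv a) = a.
Proof. symmetry. apply inv_unique, gmul_Vl. Qed.

Lemma inv_mul {G : Group} (a b : G) : ginv (a * b)%grp = (ginv b * ginv a)%grp.
Proof.
  symmetry. apply inv_unique.
  rewrite <- gmul_assoc, (gmul_assoc b), gmul_Vr, gmul_1l. apply gmul_Vr.
Qed.

Lemma mulA_rev {G : Group} (a b c : G) : ((a * b) * c = a * (b * c))%grp.
Proof. symmetry. apply gmul_assoc. Qed.

#[global] Hint Rewrite @mulA_rev @gmul_1l @gmul_1r @gmul_Vl @gmul_Vr @mulVK @mulKV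
  @inv_one @inv_inv @inv_mul : grp.

Definition conj {G : Group} (g x : G) : G := (g * x * ginv g)%grp.

(** Right association, inverses pushed onto letters and cancellation give normal forms of free-group
    words, so identities valid in every group close by reflexivity. *)
Ltac group := unfold conj, comm; autorewrite with grp; try reflexivity.

(** * Powers and products of mixed commutators *)

Section MixedCommutators.
Context {G : Group} (N : G -> Prop) (HN : normal_subgroup G N).
Local Open Scope grp_scope.

Lemma gpow_add (x : G) n m : gpow x (n + m) = gpow x n * gpow x m.
Proof. induction n as [|n IH]; simpl; [group|]. rewrite IH. group. Qed.

Lemma gpow_Sr (x : G) n : gpow x (S n) = gpow x n * x.
Proof. replace (S n) with (n + 1)%nat by lia. rewrite gpow_add. simpl. group. Qed.

Lemma gpow_inv (x : G) n : gpow (ginv x) n = ginv (gpow x n).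
Proof.
  induction n as [|n IH]; [simpl; group|].
  rewrite gpow_Sr, IH. simpl. group.
Qed.

Lemma gpow_N (x : G) n : N x -> N (gpow x n).
Proof. intros H. induction n; simpl; [apply (ns_one _ _ HN)|now apply (ns_mul _ _ HN)]. Qed.

Lemma conj_N (g x : G) : N x -> N (conj g x).
Proof. apply (ns_conj _ _ HN). Qed.

Lemma gprod_app (l l' : list G) : gprod (l ++ l') = gprod l * gprod l'.
Proof. induction l as [|x l IH]; simpl; [group|]. rewrite IH. group. Qed.

Lemma prod_gens_one : is_prod_gens N gone 0.
Proof. exists []. repeat split; constructor. Qed.

Lemma prod_gens_mul w w' k k' :
  is_prod_gens N w k -> is_prod_gens N w' k' -> is_prod_gens N (w * w') (k + k').
Proof.
  intros (l & Hl & Hf & ->) (l' & Hl' & Hf' & ->). exists (l ++ l'). repeat split.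
  - rewrite length_app. lia.
  - now apply Forall_app.
  - now rewrite map_app, gprod_app.
Qed.

Lemma prod_gens_comm g x : N x -> is_prod_gens N (comm g x) 1.
Proof.
  intros H. exists [((g, x), true)]. repeat split; auto.
  simpl. group.
Qed.

Lemma prod_gens_comm_inv g x : N x -> is_prod_gens N (ginv (comm g x)) 1.
Proof.
  intros H. exists [((g, x), false)]. repeat split; auto.
  simpl. group.
Qed.

(** Conjugation carries [a,x] to [gag^{-1}, gxg^{-1}], whose second entry stays in N by normality,
    so the number of factors is preserved. *)
Lemma prod_gens_conj g w k : is_prod_gens N w k -> is_prod_gens N (conj g w) k.
Proof.
  intros (l & <- & Hf & ->). induction l as [|[[a x] b] l IH]; simpl.
  - replace (conj g gone) with (@gone G) by group. apply prod_gens_one.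
  - inversion_clear Hf as [|? ? Hx Hl]. specialize (IH Hl).
    destruct b; simpl in *.
    + match goal with |- is_prod_gens _ (conj g (?u * ?v)) _ =>
        replace (conj g (u * v)) with (comm (conj g a) (conj g x) * conj g v) by group end.
      apply (prod_gens_mul _ _ 1); auto. now apply prod_gens_comm, conj_N.
    + match goal with |- is_prod_gens _ (conj g (?u * ?v)) _ =>
        replace (conj g (u * v)) with (ginv (comm (conj g a) (conj g x)) * conj g v) by group end.
      apply (prod_gens_mul _ _ 1); auto. now apply prod_gens_comm_inv, conj_N.
Qed.

Lemma prod_gens_rot u v k : is_prod_gens N (u * v) k -> is_prod_gens N (v * u) k.
Proof.
  intros H. apply (prod_gens_conj (ginv u)) in H. revert H. group. auto.
Qed.

(** The number of factors is exact in [is_prod_gens]; copies of [1,1] pad a shorter product. *)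
Lemma prod_gens_le w k k' : (k <= k')%nat -> is_prod_gens N w k -> is_prod_gens N w k'.
Proof.
  induction 1; auto. intros Hw.
  replace w with (comm gone gone * w) by group.
  apply (prod_gens_mul _ _ 1); auto. apply prod_gens_comm, (ns_one _ _ HN).
Qed.

(** * Products of conjugates and surfaces with given boundary loops *)

(** A pair holds the path to a boundary loop and the loop itself. Unlike in [conj_word], the first
    factor may be conjugated too. *)
Definition conj_prod (l : list (G * G)) : G :=
  gprod (map (fun p => conj (fst p) (snd p)) l).

Lemma conj_prod_app l l' : conj_prod (l ++ l') = conj_prod l * conj_prod l'.
Proof. unfold conj_prod. now rewrite map_app, gprod_app. Qed.

Lemma conj_prod_cons g x l : conj_prod ((g, x) :: l) = conj g x * conj_prod l.
Proof. reflexivity. Qed.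

Lemma conj_prod_conj g l :
  conj g (conj_prod l) = conj_prod (map (fun p => (g * fst p, snd p)) l).
Proof.
  induction l as [|[a x] l IH]; simpl.
  - unfold conj_prod. simpl. group.
  - rewrite !conj_prod_cons, <- IH. group.
Qed.

Lemma map_snd_shift (g : G) (l : list (G * G)) :
  map snd (map (fun p => (g * fst p, snd p)) l) = map snd l.
Proof. rewrite map_map. apply map_ext. auto. Qed.

(** As uv = (uvu^{-1})u, a factor jumps to the front once the product before it is absorbed into its
    conjugator. *)
Lemma conj_prod_front l x hs : Permutation (map snd l) (x :: hs) ->
  exists g l', Permutation (map snd l') hs /\ conj_prod l = conj g x * conj_prod l'.
Proof.
  intros H. assert (Hin : In x (map snd l)).
  { eapply Permutation_in; [symmetry; apply H|now left]. }
  apply in_map_iff in Hin. destruct Hin as ([a y] & Hy & Hin). simpl in Hy. subst y.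
  apply in_split in Hin. destruct Hin as (l1 & l2 & ->).
  exists (conj_prod l1 * a), (l1 ++ l2). split.
  - rewrite map_app in *. simpl in H.
    symmetry. apply Permutation_cons_app_inv with x. now symmetry.
  - rewrite !conj_prod_app, conj_prod_cons. group.
Qed.

Lemma conj_prod_reorder l hs : Permutation (map snd l) hs ->
  exists l', map snd l' = hs /\ conj_prod l' = conj_prod l.
Proof.
  revert l. induction hs as [|x hs IH]; intros l H.
  - exists []. split; auto. symmetry in H. apply Permutation_nil in H.
    now destruct l.
  - destruct (conj_prod_front _ _ _ H) as (g & l' & Hl' & ->).
    destruct (IH _ Hl') as (l'' & <- & <-). now exists ((g, x) :: l'').
Qed.

(* [Fill hs K] says that the union of loops [hs] bounds a surface built from [K] handles. *)
Definition Fill (hs : list G) (K : nat) : Prop :=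
  exists l, Permutation (map snd l) hs /\ is_prod_gens N (conj_prod l) K.

Lemma Fill_perm hs hs' K : Permutation hs hs' -> Fill hs K -> Fill hs' K.
Proof. intros H (l & Hl & Hp). exists l. split; auto. now rewrite Hl. Qed.

Lemma Fill_le hs K K' : (K <= K')%nat -> Fill hs K -> Fill hs K'.
Proof. intros H (l & Hl & Hp). exists l. split; auto. now apply prod_gens_le with K. Qed.

Lemma Fill_nil : Fill [] 0.
Proof. exists []. split; auto. apply prod_gens_one. Qed.

Lemma Fill_app hs hs' K K' : Fill hs K -> Fill hs' K' -> Fill (hs ++ hs') (K + K').
Proof.
  intros (l & Hl & Hp) (l' & Hl' & Hp'). exists (l ++ l'). split.
  - rewrite map_app. now apply Permutation_app.
  - rewrite conj_prod_app. now apply prod_gens_mul.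
Qed.

(** Conjugating the whole product moves the base point onto the loop [x], whose own conjugator
    becomes trivial. *)
Lemma Fill_cons_inv x hs K : Fill (x :: hs) K ->
  exists l, Permutation (map snd l) hs /\ is_prod_gens N (x * conj_prod l) K.
Proof.
  intros (l & Hl & Hp). destruct (conj_prod_front _ _ _ Hl) as (g & l' & Hl' & He).
  rewrite He in Hp. exists (map (fun p => (ginv g * fst p, snd p)) l'). split.
  - now rewrite map_snd_shift.
  - rewrite <- conj_prod_conj. apply (prod_gens_conj (ginv g)) in Hp.
    revert Hp. group. auto.
Qed.

Lemma Fill_cons x l hs K : Permutation (map snd l) hs ->
  is_prod_gens N (x * conj_prod l) K -> Fill (x :: hs) K.
Proof.
  intros Hl Hp. exists ((gone, x) :: l). split; [now constructor|].
  rewrite conj_prod_cons. revert Hp. group. auto.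
Qed.

Lemma Fill_conj g x hs K : Fill (conj g x :: hs) K <-> Fill (x :: hs) K.
Proof.
  split; intros H; apply Fill_cons_inv in H; destruct H as (l & Hl & Hp).
  - exists ((g, x) :: l). split; [now constructor|exact Hp].
  - exists ((ginv g, conj g x) :: l). split; [now constructor|].
    rewrite conj_prod_cons. revert Hp. group. auto.
Qed.

Lemma Fill_rot u v hs K : Fill (u * v :: hs) K <-> Fill (v * u :: hs) K.
Proof.
  rewrite <- (Fill_conj v (u * v)).
  replace (conj v (u * v)) with (v * u) by group. reflexivity.
Qed.

(** A band between boundary loops of two disjoint surfaces adds the genera and makes no handle. *)
Lemma Fill_connect x y hs hs' K K' :
  Fill (x :: hs) K -> Fill (y :: hs') K' -> Fill (x * y :: hs ++ hs') (K + K').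
Proof.
  intros H H'. apply Fill_cons_inv in H. apply Fill_cons_inv in H'.
  destruct H as (l & Hl & Hp), H' as (l' & Hl' & Hp').
  apply (Fill_cons _ (l' ++ l)).
  - rewrite map_app, Hl, Hl'. apply Permutation_app_comm.
  - apply prod_gens_rot in Hp. rewrite conj_prod_app.
    apply prod_gens_rot. replace (conj_prod l' * conj_prod l * (x * y))
      with (conj_prod l' * ((conj_prod l * x) * y)) by group.
    apply prod_gens_rot. rewrite <- gmul_assoc. now apply prod_gens_mul.
Qed.

(** A band between two boundary loops of the same surface makes a handle. Algebraically gyg^{-1} =
    [g,y]y, so trading the conjugate of y for y costs one commutator, which is mixed since y lies in
    N. *)
Lemma Fill_handle x y hs K : N y -> Fill (x :: y :: hs) K -> Fill (x * y :: hs) (S K).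
Proof.
  intros Hy H. apply Fill_cons_inv in H. destruct H as (l & Hl & Hp).
  destruct (conj_prod_front _ _ _ Hl) as (g & l' & Hl' & He). rewrite He in Hp.
  apply (Fill_cons _ l'); auto.
  replace (x * y * conj_prod l')
    with (conj x (ginv (comm g y)) * (x * (conj g y * conj_prod l'))) by group.
  apply (prod_gens_mul _ _ 1); auto. now apply prod_gens_conj, prod_gens_comm_inv.
Qed.

(** The conjugator [g] becomes the path to the new loop, so a boundary loop is cut in two at no cost
    in genus. *)
Lemma Fill_split x g y hs K : Fill (x * conj g y :: hs) K -> Fill (x :: y :: hs) K.
Proof.
  intros H. apply Fill_cons_inv in H. destruct H as (l & Hl & Hp).
  apply (Fill_cons _ ((g, y) :: l)); [now constructor|].
  rewrite conj_prod_cons. revert Hp. group. auto.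
Qed.

Lemma Fill_one hs K : Fill (gone :: hs) K -> Fill hs K.
Proof.
  intros H. apply Fill_cons_inv in H. destruct H as (l & Hl & Hp).
  exists l. split; auto. now rewrite gmul_1l in Hp.
Qed.

Lemma Fill_ones {A} (f : A -> G) l hs K : (forall a, In a l -> f a = gone) ->
  Fill (map f l ++ hs) K -> Fill hs K.
Proof.
  induction l as [|a l IH]; simpl; intros Hl H; auto.
  rewrite (Hl a) in H by auto. apply IH; auto. now apply Fill_one.
Qed.

Lemma Fill_inv_pair x : Fill [ginv x; x] 0.
Proof.
  exists [(gone, ginv x); (gone, x)]. split; auto. unfold conj_prod. simpl.
  match goal with |- is_prod_gens _ ?w _ => replace w with (@gone G) by group end.
  apply prod_gens_one.
Qed.

(** ** Mixed commutator length of chains *)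

Lemma conj_tail_conj_prod (gs zs : list G) : length gs = length zs ->
  exists l, map snd l = zs /\ conj_tail gs zs = conj_prod l.
Proof.
  revert zs. induction gs as [|g gs IH]; intros [|x zs] Hlen; try discriminate.
  - now exists [].
  - destruct (IH zs) as (l & <- & Hl); [simpl in Hlen; lia|].
    exists ((g, x) :: l). split; auto. simpl. now rewrite Hl.
Qed.

Lemma conj_word_Fill zs gs K : length gs = pred (length zs) ->
  is_prod_gens N (conj_word zs gs) K -> Fill zs K.
Proof.
  destruct zs as [|z zs]; simpl; intros Hlen H.
  - exists []. split; auto.
  - destruct (conj_tail_conj_prod gs zs) as (l & <- & Hl); [auto|].
    apply (Fill_cons _ l); [reflexivity|]. now rewrite <- Hl.
Qed.

(** The base point is put on the first loop, which [conj_word] leaves unconjugated; the other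
    factors are then brought into the prescribed order. *)
Lemma Fill_conj_word zs K : Fill zs K ->
  exists gs, length gs = pred (length zs) /\ is_prod_gens N (conj_word zs gs) K.
Proof.
  destruct zs as [|z zs]; intros H.
  - exists []. split; auto. destruct H as (l & Hl & Hp). symmetry in Hl.
    apply Permutation_nil in Hl. destruct l; [exact Hp|discriminate].
  - apply Fill_cons_inv in H. destruct H as (l & Hl & Hp).
    destruct (conj_prod_reorder _ _ Hl) as (l' & <- & He). rewrite <- He in Hp.
    exists (map fst l'). split; [simpl; now rewrite !length_map|].
    simpl. replace (conj_tail (map fst l') (map snd l')) with (conj_prod l'); auto.
    clear. induction l' as [|[a x] l IH]; auto. simpl. now rewrite <- IH.
Qed.

Lemma Fill_gprod zs x hs K : Forall N zs -> Fill (x :: zs ++ hs) K ->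
  exists K', Fill (x * gprod zs :: hs) K'.
Proof.
  revert x K. induction zs as [|z zs IH]; simpl; intros x K HF H.
  - exists K. now rewrite gmul_1r.
  - inversion_clear HF. apply Fill_handle in H; auto.
    destruct (IH (x * z) _ H1 H) as (K' & HK'). exists K'.
    revert HK'. group. auto.
Qed.

Lemma Fill_conj_list (l : list (G * G)) hs K :
  Fill (map snd l ++ hs) K -> Fill (map (fun p => conj (fst p) (snd p)) l ++ hs) K.
Proof.
  revert hs. induction l as [|[g x] l IH]; simpl; intros hs H; auto.
  apply Fill_conj. apply (Fill_perm (map (fun p => conj (fst p) (snd p)) l ++ x :: hs)).
  { symmetry. apply Permutation_middle. }
  apply IH. apply (Fill_perm (x :: map snd l ++ hs)); auto. apply Permutation_middle.
Qed.

(** [real] sends an infinite infimum to 0, so conjugators whose word is no product of mixed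
    commutators would give [cl] the spurious value 0. Merging all loops by handles rules this
    out. *)
Lemma Fill_every_conj_word zs gs K : Forall N zs -> length gs = pred (length zs) ->
  Fill zs K -> exists K', is_prod_gens N (conj_word zs gs) K'.
Proof.
  destruct zs as [|z zs]; intros HF Hlen H.
  - exists 0%nat. apply prod_gens_one.
  - inversion_clear HF as [|? ? Hz Hzs]. simpl in *.
    destruct (conj_tail_conj_prod gs zs Hlen) as (l & <- & ->).
    assert (H' : Fill (z :: map (fun p => conj (fst p) (snd p)) l ++ []) K).
    { rewrite <- (app_nil_r (z :: _)) in H.
      apply (Fill_conj_list ((gone, z) :: l)) in H. simpl in H.
      now replace (conj gone z) with z in H by group. }
    apply Fill_gprod in H'.
    + destruct H' as (K' & HK'). exists K'. apply Fill_cons_inv in HK'.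
      destruct HK' as (l' & Hl' & Hp). symmetry in Hl'. apply Permutation_nil in Hl'.
      destruct l'; [|discriminate]. change (conj_prod []) with (@gone G) in Hp.
      now rewrite gmul_1r in Hp.
    + rewrite Forall_map in *. revert Hzs. apply Forall_impl. intros p. apply conj_N.
Qed.


(** ** Gluing polygons *)

(* A letter is an oriented edge; a word is the boundary circle of a surface. *)
Definition lval (a : bool * G) : G := if fst a then snd a else ginv (snd a).
Definition flip (a : bool * G) : bool * G := (negb (fst a), snd a).
Definition wval (w : list (bool * G)) : G := gprod (map lval w).
Definition sign (b : bool) : R := if b then 1 else -1.

Definition edge_sum (w : list (bool * G)) (h : G) : R :=
  fold_right (fun a acc => sign (fst a) * delta (snd a) h + acc)%R 0%R w.

Definition balanced (w : list (bool * G)) : Prop := forall h, edge_sum w h = 0%R.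

Definition outside (a : bool * G) : bool :=
  if excluded_middle_informative (N (snd a)) then false else true.

Definition n_out (w : list (bool * G)) : nat := length (filter outside w).

(* The projection of a triangle of [C'_2] to [G/N] has an edge labelled 1 and two mutually
   inverse ones; this survives gluing as long as edges outside [N] are glued first. *)
Definition admissible (w : list (bool * G)) : Prop :=
  N (wval w) /\ (n_out w = 0%nat \/ n_out w = 2%nat).

Lemma lval_flip a : lval (flip a) = ginv (lval a).
Proof. destruct a as [[|] g]; unfold lval; simpl; group. Qed.

Lemma outside_flip a : outside (flip a) = outside a.
Proof. reflexivity. Qed.

Lemma wval_app u v : wval (u ++ v) = wval u * wval v.
Proof. unfold wval. now rewrite map_app, gprod_app. Qed.

Lemma wval_cons a v : wval (a :: v) = lval a * wval v.
Proof. reflexivity. Qed.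

Lemma n_out_app u v : n_out (u ++ v) = (n_out u + n_out v)%nat.
Proof. unfold n_out. now rewrite filter_app, length_app. Qed.

Lemma n_out_cons a v : n_out (a :: v) = ((if outside a then 1 else 0) + n_out v)%nat.
Proof. unfold n_out. simpl. now destruct (outside a). Qed.

Lemma inside_N a : outside a = false -> N (lval a).
Proof.
  unfold outside, lval. destruct (excluded_middle_informative _); [|discriminate].
  intros _. destruct (fst a); auto. now apply (ns_inv _ _ HN).
Qed.

Lemma n_out_0_admissible w : n_out w = 0%nat -> admissible w.
Proof.
  intros H. split; auto. revert H. induction w as [|a w IH]; intros H.
  - apply (ns_one _ _ HN).
  - rewrite n_out_cons in H. destruct (outside a) eqn:Ha; [discriminate|].
    rewrite wval_cons. apply (ns_mul _ _ HN); [now apply inside_N|]. now apply IH.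
Qed.

Lemma N_rot x y : N (x * y) -> N (y * x).
Proof. intros H. apply (conj_N y) in H. revert H. group. auto. Qed.

Lemma admissible_rot u v : admissible (u ++ v) -> admissible (v ++ u).
Proof.
  intros [H1 H2]. rewrite wval_app in *. split.
  - rewrite wval_app. now apply N_rot.
  - rewrite n_out_app in *. lia.
Qed.

Lemma edge_sum_app u v h : edge_sum (u ++ v) h = (edge_sum u h + edge_sum v h)%R.
Proof. induction u as [|a u IH]; simpl; [lra|]. rewrite IH. lra. Qed.

Lemma edge_sum_perm u v h : Permutation u v -> edge_sum u h = edge_sum v h.
Proof. induction 1; simpl; lra. Qed.

Lemma balanced_perm u v : Permutation u v -> balanced u -> balanced v.
Proof. intros H Hu h. rewrite <- (edge_sum_perm _ _ h H). apply Hu. Qed.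

Lemma edge_sum_cons a w h : edge_sum (a :: w) h = (sign (fst a) * delta (snd a) h + edge_sum w h)%R.
Proof. reflexivity. Qed.

Lemma sign_negb b : sign (negb b) = (- sign b)%R.
Proof. destruct b; simpl; lra. Qed.

Ltac edge_arith := simpl in *;
  repeat (rewrite edge_sum_app in * || rewrite edge_sum_cons in *);
  unfold flip in *; simpl in *; try rewrite sign_negb in *; lra.

Lemma delta_same (g : G) : delta g g = 1%R.
Proof. unfold delta. destruct (excluded_middle_informative _); tauto. Qed.

Lemma delta_neq (g h : G) : g <> h -> delta g h = 0%R.
Proof. unfold delta. destruct (excluded_middle_informative _); tauto. Qed.

(** Without an opposite letter, all occurrences of the edge of [a] would carry the same sign, and
    its coefficient could not vanish. *)
Lemma balanced_partner a w : balanced (a :: w) -> In (flip a) w.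
Proof.
  intros H. apply NNPP. intros Hn. specialize (H (snd a)). simpl in H.
  rewrite delta_same in H.
  assert (Hw : (0 <= sign (fst a) * edge_sum w (snd a))%R).
  { clear H. induction w as [|b w IH]; simpl; [lra|].
    assert (~ In (flip a) w) as Hw by (intros ?; apply Hn; now right).
    specialize (IH Hw). rewrite Rmult_plus_distr_l.
    assert (0 <= sign (fst a) * (sign (fst b) * delta (snd b) (snd a)))%R; [|lra].
    destruct (classic (snd b = snd a)) as [He|He].
    - rewrite He, delta_same. destruct a as [[|] g], b as [[|] g']; simpl in *; subst; try lra;
        exfalso; apply Hn; now left.
    - rewrite delta_neq by auto. lra. }
  destruct (fst a); simpl in *; lra.
Qed.

(* A connected surface of genus [K] with boundary [ws ++ hs]. The last equation computes its
   Euler characteristic: a glued polygon with [n] edges and [r] holes counts [n + r - 2] in [F]. *)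
Definition surface (ws : list (list (bool * G))) (hs : list G) (K F : nat) : Prop :=
  Forall admissible ws /\ Fill (map wval ws ++ hs) K /\
  (4 * K + 2 * length ws + length (concat ws) + length hs = F + 4)%nat.

Lemma concat_perm {A} (l l' : list (list A)) :
  Permutation l l' -> Permutation (concat l) (concat l').
Proof.
  induction 1; simpl; auto.
  - now apply Permutation_app_head.
  - rewrite !app_assoc. apply Permutation_app_tail, Permutation_app_comm.
  - etransitivity; eauto.
Qed.

Lemma surface_perm ws ws' hs K F :
  Permutation ws ws' -> surface ws hs K F -> surface ws' hs K F.
Proof.
  intros H (H1 & H2 & H3). repeat split.
  - now rewrite <- H.
  - apply (Fill_perm (map wval ws ++ hs)); auto.
    now apply Permutation_app_tail, Permutation_map.
  - rewrite <- (Permutation_length H), <- (Permutation_length (concat_perm _ _ H)). auto.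
Qed.

Lemma surface_rot u v ws hs K F :
  surface ((u ++ v) :: ws) hs K F -> surface ((v ++ u) :: ws) hs K F.
Proof.
  intros (H1 & H2 & H3). inversion_clear H1. repeat split.
  - constructor; auto. now apply admissible_rot.
  - simpl in *. rewrite wval_app in *. now apply Fill_rot.
  - simpl in *. rewrite !length_app in *. lia.
Qed.

(** Gluing two edges of one boundary word cuts it in two: one word more, two edges fewer, same
    genus. If [a] is outside N, the glued letters are the only two outside; otherwise the word has
    none. Either way both pieces lie inside N. *)
Lemma surface_glue_same a p q ws hs K F :
  (outside a = false -> n_out (a :: p ++ flip a :: q) = 0%nat) ->
  surface ((a :: p ++ flip a :: q) :: ws) hs K F -> surface (q :: p :: ws) hs K F.
Proof.
  intros H0 (H1 & H2 & H3). inversion_clear H1 as [|? ? [_ Hn] Hws]. repeat split.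
  - rewrite n_out_cons, n_out_app, n_out_cons, outside_flip in Hn, H0.
    apply Forall_cons; [|apply Forall_cons; auto];
      apply n_out_0_admissible; destruct (outside a); simpl in *; lia.
  - simpl in *. apply Fill_split with (lval a). apply Fill_rot.
    rewrite wval_cons, wval_app, wval_cons, lval_flip in H2. revert H2. group. auto.
  - simpl in *. repeat (rewrite !length_app in * || simpl in * ); lia.
Qed.

(** The values wa and a^{-1}qp lie in N, hence so does wqp. If [a] is outside N, each word keeps one
    outside letter, two in all; if inside, [w] has none and the count is that of the other word. *)
Lemma admissible_merge a w p q : admissible (a :: w) -> admissible (p ++ flip a :: q) ->
  (outside a = false -> n_out (a :: w) = 0%nat) -> admissible (w ++ q ++ p).
Proof.
  intros [H1 H2] [H3 H4] H0. split.
  - rewrite !wval_app. rewrite wval_app, wval_cons, lval_flip in H3. rewrite wval_cons in H1.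
    apply N_rot in H1. apply N_rot in H3.
    pose proof (ns_mul _ _ HN _ _ H1 H3) as H. revert H. group. auto.
  - rewrite !n_out_app. rewrite n_out_app in H4.
    rewrite n_out_cons in *. rewrite outside_flip in H4. destruct (outside a); simpl in *; lia.
Qed.

(** Gluing edges of two boundary words of one connected surface makes a handle: plus 4 in the Euler
    count, against one word and two edges lost. The handle is mixed because an admissible word has
    value in N. *)
Lemma surface_glue_other a w p q ws hs K F :
  (outside a = false -> n_out (a :: w) = 0%nat) ->
  surface ((a :: w) :: (p ++ flip a :: q) :: ws) hs K F ->
  surface ((w ++ q ++ p) :: ws) hs (S K) F.
Proof.
  intros H0 (H1 & H2 & H3). inversion_clear H1 as [|? ? Ha Hws].
  inversion_clear Hws as [|? ? Hb Hws']. repeat split.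
  - constructor; auto. now apply (admissible_merge a).
  - simpl in *. rewrite wval_cons, wval_app, wval_cons, lval_flip in H2.
    apply Fill_rot in H2.
    apply (Fill_perm _ (wval p * (ginv (lval a) * wval q) :: wval w * lval a :: map wval ws ++ hs))
      in H2; [|constructor].
    apply Fill_rot in H2.
    apply (Fill_perm _ (wval w * lval a :: (ginv (lval a) * wval q * wval p) :: map wval ws ++ hs))
      in H2; [|constructor].
    apply Fill_handle in H2.
    + rewrite !wval_app. revert H2. group. auto.
    + destruct Hb as [Hb _]. rewrite wval_app, wval_cons, lval_flip in Hb. now apply N_rot.
  - simpl in *. repeat (rewrite !length_app in * || simpl in * ); lia.
Qed.

(** A polygon not yet glued, possibly with holes: a triangle has three edges, a cap one edge and one
    hole. The last bound keeps the truncated subtraction in n + r - 2 exact. *)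
Definition cell (c : list (bool * G) * list G) : Prop :=
  admissible (fst c) /\ Fill (wval (fst c) :: snd c) 0 /\
  (1 <= length (fst c))%nat /\ (2 <= length (fst c) + length (snd c))%nat.

(** The cell is a separate piece of genus 0, so attaching it is a band sum and makes no handle. *)
Lemma surface_glue_cell a w p q hs' ws hs K F :
  (outside a = false -> n_out (a :: w) = 0%nat) ->
  surface ((a :: w) :: ws) hs K F -> cell (p ++ flip a :: q, hs') ->
  surface ((w ++ q ++ p) :: ws) (hs ++ hs') K
    (F + (length (p ++ flip a :: q) + length hs' - 2)).
Proof.
  intros H0 (H1 & H2 & H3) (C1 & C2 & C3 & C4). inversion_clear H1 as [|? ? Ha Hws].
  simpl in *. repeat split.
  - constructor; auto. now apply (admissible_merge a).
  - simpl in *. rewrite wval_cons in H2. rewrite wval_app, wval_cons, lval_flip in C2.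
    apply Fill_rot in H2. apply Fill_rot in C2.
    pose proof (Fill_connect _ _ _ _ _ _ H2 C2) as H. rewrite Nat.add_0_r in H.
    rewrite <- app_assoc in H. rewrite !wval_app. revert H. group. auto.
  - simpl in *. repeat (rewrite !length_app in * || simpl in * ); lia.
Qed.

Lemma exists_gluing_letter w : w <> [] -> exists a u v,
  w = u ++ a :: v /\ (outside a = false -> n_out w = 0%nat).
Proof.
  intros Hw. destruct (filter outside w) as [|a l] eqn:Hf.
  - destruct w as [|a w]; [easy|]. exists a, [], w. split; auto.
    intros _. unfold n_out. now rewrite Hf.
  - assert (Ha : In a w /\ outside a = true).
    { apply filter_In. rewrite Hf. now left. }
    destruct Ha as [Ha Ho]. apply in_split in Ha. destruct Ha as (u & v & ->).
    exists a, u, v. split; auto. rewrite Ho. discriminate.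
Qed.

(* Closed components are discarded, the others contribute by their Euler characteristic. *)
Lemma glue_all n : forall ws hs K F cs, ws <> [] -> surface ws hs K F ->
  Forall cell cs -> balanced (concat ws ++ concat (map fst cs)) ->
  (length (concat ws) + length (concat (map fst cs)) + length cs <= n)%nat ->
  exists K', Fill (hs ++ concat (map snd cs)) K' /\
    (4 * K' + 2 * length cs <=
     F + length hs + length (concat (map fst cs)) + 2 * length (concat (map snd cs)))%nat.
Proof.
  induction n as [n IH] using (well_founded_induction Nat.lt_wf_0).
  intros ws hs K F cs Hne Hs Hcs Hbal Hn.
  destruct (classic (forall w, In w ws -> w = [])) as [Hall|Hex].
  - assert (Hc : concat ws = []).
    { clear - Hall. induction ws as [|w ws IH]; simpl; auto.
      rewrite (Hall w), IH; auto; [|now left]. intros; apply Hall; now right. }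
    destruct Hs as (H1 & H2 & H3). rewrite Hc in *. simpl in Hbal, H3, Hn.
    (* All edges of this component are glued. Without holes it is dropped; otherwise one word and
       one hole at least make the Euler equation yield the bound. *)
    assert (HF : exists K1, Fill hs K1 /\ (4 * K1 <= F + length hs)%nat).
    { destruct hs as [|x hs].
      - exists 0%nat. split; [apply Fill_nil|lia].
      - exists K. split; [|destruct ws; [easy|]; simpl in *; lia].
        apply (Fill_ones wval ws); auto.
        intros w Hw. now rewrite (Hall w). }
    destruct HF as (K1 & HK1 & HF).
    (* A remaining cell seeds a new component of genus 0. *)
    destruct cs as [|[w hs'] cs]; simpl in *.
    + exists K1. rewrite app_nil_r. split; auto. lia.
    + destruct (Forall_inv Hcs) as (C1 & C2 & C3 & C4).
      pose proof (Forall_inv_tail Hcs) as Hcs'. simpl in *.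
      rewrite length_app in *.
      edestruct (IH (n - 1)%nat) with (ws := [w]) (hs := hs') (K := 0%nat) (cs := cs)
        (F := (length w + length hs' - 2)%nat) as (K2 & HK2 & HF2); auto; try easy; try lia.
      * repeat split; auto. simpl. rewrite app_nil_r. lia.
      * simpl. now rewrite app_nil_r.
      * simpl. rewrite app_nil_r. lia.
      * exists (K1 + K2)%nat. split; [now apply Fill_app|]. rewrite length_app. lia.
  - assert (Hw : exists w, In w ws /\ w <> []).
    { apply not_all_ex_not in Hex. destruct Hex as (w & Hw). exists w. tauto. }
    destruct Hw as (w & Hin & Hw).
    apply in_split in Hin. destruct Hin as (l1 & l2 & ->).
    assert (HP : Permutation (l1 ++ w :: l2) (w :: l1 ++ l2))
      by (symmetry; apply Permutation_middle).
    apply (surface_perm _ _ _ _ _ HP) in Hs.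
    pose proof (concat_perm _ _ HP) as HPc.
    apply (balanced_perm _ _ (Permutation_app_tail _ HPc)) in Hbal.
    rewrite (Permutation_length HPc) in Hn. clear HP HPc Hne Hex.
    set (rest := l1 ++ l2) in *. clearbody rest. clear l1 l2.
    destruct (exists_gluing_letter w Hw) as (a & u & v & -> & Ha). clear Hw.
    apply surface_rot in Hs. simpl in Hs, Hbal, Hn.
    replace (n_out (u ++ a :: v)) with (n_out (a :: v ++ u)) in Ha
      by (rewrite (n_out_app u), !n_out_cons, n_out_app; lia).
    assert (Hbal' : balanced (a :: (v ++ u) ++ concat rest ++ concat (map fst cs))).
    { intros h. specialize (Hbal h). edge_arith. }
    clear Hbal. rename Hbal' into Hbal.
    assert (Hn' : (length (v ++ u) + length (concat rest) + length (concat (map fst cs))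
                   + length cs < n)%nat)
      by (rewrite !length_app in *; simpl in *; rewrite ?length_app in *; lia).
    set (w := v ++ u) in *. clearbody w. clear Hn u v.
    (* The opposite edge lies in the same word, in another word of the component, or in an
       unattached cell. *)
    pose proof (balanced_partner _ _ Hbal) as Hin.
    apply in_app_or in Hin. rewrite in_app_iff in Hin. destruct Hin as [Hin|[Hin|Hin]].
    + apply in_split in Hin. destruct Hin as (p & q & ->).
      apply surface_glue_same in Hs; auto.
      apply (IH (n - 1)%nat) with (ws := q :: p :: rest) (K := K); auto; try easy; try lia.
      * intros h. specialize (Hbal h). edge_arith.
      * simpl. rewrite !length_app in *. simpl in *. lia.
    + apply in_concat in Hin. destruct Hin as (w' & Hw' & Hin).
      apply in_split in Hw'. destruct Hw' as (l1 & l2 & ->).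
      assert (HP : Permutation (l1 ++ w' :: l2) (w' :: l1 ++ l2))
        by (symmetry; apply Permutation_middle).
      apply (surface_perm _ _ _ _ _ (Permutation_cons eq_refl HP)) in Hs.
      pose proof (concat_perm _ _ HP) as HPc.
      apply in_split in Hin. destruct Hin as (p & q & ->).
      apply surface_glue_other in Hs; auto.
      apply (IH (n - 1)%nat) with (ws := (w ++ q ++ p) :: l1 ++ l2) (K := S K); auto; try easy; try lia.
      * intros h. specialize (Hbal h). pose proof (edge_sum_perm _ _ h HPc). edge_arith.
      * rewrite (Permutation_length HPc) in Hn'. simpl in *.
        rewrite !length_app in *. simpl in *. lia.
    + apply in_concat in Hin. destruct Hin as (w' & Hw' & Hin).
      apply in_map_iff in Hw'. destruct Hw' as ([w2 hs'] & Hw2 & Hc). simpl in Hw2. subst w2.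
      apply in_split in Hc. destruct Hc as (l1 & l2 & ->).
      assert (HP : Permutation (l1 ++ (w', hs') :: l2) ((w', hs') :: l1 ++ l2))
        by (symmetry; apply Permutation_middle).
      rewrite HP in Hcs. inversion_clear Hcs as [|? ? Hc Hcs'].
      pose proof (concat_perm _ _ (Permutation_map fst HP)) as HP1.
      pose proof (concat_perm _ _ (Permutation_map snd HP)) as HP2.
      rewrite (Permutation_length HP1) in *. rewrite (Permutation_length HP2).
      rewrite (Permutation_length HP) in *.
      apply in_split in Hin. destruct Hin as (p & q & ->).
      pose proof (surface_glue_cell _ _ _ _ _ _ _ _ _ Ha Hs Hc) as Hs'.
      destruct Hc as (_ & _ & C3 & C4).
      edestruct (IH (n - 1)%nat) with (ws := (w ++ q ++ p) :: rest) (cs := l1 ++ l2)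
        as (K' & HK' & HF'); try exact Hs'; auto; try easy; try lia.
      * intros h. specialize (Hbal h). pose proof (edge_sum_perm _ _ h HP1). edge_arith.
      * simpl in *. rewrite !length_app in *. simpl in *. lia.
      * exists K'. split.
        -- revert HK'. apply Fill_perm. rewrite <- app_assoc.
           apply Permutation_app_head. now rewrite HP2.
        -- simpl in *. rewrite !length_app in *. simpl in *. lia.
Qed.


(** ** From integral fillings to surfaces *)

Definition in_tri (t : G * G) : Prop := N (fst t) \/ N (snd t).

(** The letters multiply to 1 around the triangle, while their signed sum is plus or minus the
    boundary of (g,h). *)
Definition tri_word (t : bool * (G * G)) : list (bool * G) :=
  let (g, h) := snd t in
  if fst t then [(true, g); (true, h); (false, g * h)]
  else [(false, h); (false, g); (true, g * h)].

Definition tri_bd (T : list (bool * (G * G))) : chain1 G :=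
  edge_sum (concat (map tri_word T)).

Lemma n_out_N x b w : N x -> n_out ((b, x) :: w) = n_out w.
Proof.
  intros H. rewrite n_out_cons. unfold outside. simpl.
  now destruct (excluded_middle_informative _).
Qed.

(** When one of g, h lies in N, the other and gh are both in N or both outside, so zero or two edges
    are outside. *)
Lemma tri_cell t : in_tri (snd t) -> cell (tri_word t, []).
Proof.
  intros H. repeat split; simpl.
  - destruct t as [[|] [g h]]; unfold wval, lval; simpl; group; apply (ns_one _ _ HN).
  - assert (HNgh : forall a b, N a -> (N (a * b) <-> N b)).
    { intros a b Ha. split; [|now apply (ns_mul _ _ HN)].
      intros Hab. rewrite <- (mulVK a b). apply (ns_mul _ _ HN); auto. now apply (ns_inv _ _ HN). }
    assert (HNhg : forall a b, N b -> (N (a * b) <-> N a)).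
    { intros a b Hb. split; intros Hab; [|now apply (ns_mul _ _ HN)].
      apply N_rot in Hab. now apply HNgh in Hab. }
    destruct t as [b [g h]]. unfold in_tri in H. simpl in H.
    assert (He : n_out (tri_word (b, (g, h)))
      = n_out [(true, g); (true, h); (true, g * h)]).
    { unfold n_out, outside. destruct b; simpl;
        repeat destruct (excluded_middle_informative _); auto. }
    rewrite He. unfold n_out, outside. simpl.
    repeat destruct (excluded_middle_informative _); simpl; auto; exfalso; firstorder.
  - exists [(gone, gone)]. split.
    + destruct t as [[|] [g h]]; unfold wval, lval; simpl; group.
    + unfold conj_prod. simpl. group. apply prod_gens_one.
  - destruct t as [[|] [g h]]; simpl; lia.
  - destruct t as [[|] [g h]]; simpl; lia.
Qed.

Lemma cap_cell a : N (snd a) -> cell ([flip a], [lval a]).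
Proof.
  intros H. repeat split; simpl; auto; try lia.
  - apply (n_out_0_admissible [flip a]). unfold flip. rewrite n_out_N; auto.
  - left. unfold flip. rewrite n_out_N; auto.
  - replace (wval [flip a]) with (ginv (lval a)); [apply Fill_inv_pair|].
    unfold wval. simpl. rewrite lval_flip. group.
Qed.

Lemma tri_bd_cons t T h : tri_bd (t :: T) h =
  (sign (fst t) * (delta (snd (snd t)) h - delta (gmul (fst (snd t)) (snd (snd t))) h
     + delta (fst (snd t)) h) + tri_bd T h)%R.
Proof.
  unfold tri_bd. simpl. rewrite edge_sum_app.
  destruct t as [[|] [g k]]; simpl; lra.
Qed.

(* The gluing starts from a closed component with two empty boundary words and ends by capping:
   each letter of [A] is glued to a one-edge polygon with a hole. *)
Lemma Fill_of_triangles T A : Forall (fun t => in_tri (snd t)) T -> Forall (fun a => N (snd a)) A ->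
  (forall h, tri_bd T h = edge_sum A h) ->
  exists K, Fill (map lval A) K /\ (4 * K <= length T + length A)%nat.
Proof.
  intros HT HA Hbd.
  set (cs := map (fun t => (tri_word t, @nil G)) T ++ map (fun a => ([flip a], [lval a])) A).
  assert (Hc1 : concat (map fst cs) = concat (map tri_word T) ++ map flip A).
  { unfold cs. rewrite map_app, concat_app, !map_map. simpl. f_equal.
    clear. induction A; simpl; congruence. }
  assert (Hc2 : concat (map snd cs) = map lval A).
  { unfold cs. rewrite map_app, concat_app, !map_map. simpl.
    replace (concat (map (fun _ => []) T)) with (@nil G); [|clear; now induction T].
    simpl. clear. induction A; simpl; congruence. }
  assert (Hl : length (concat (map tri_word T)) = (3 * length T)%nat).
  { clear. induction T as [|[[|] [g h]] T IH]; simpl in *; lia. }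
  (* Two empty words satisfy the Euler equation with K = F = 0. *)
  destruct (glue_all (length (concat (map fst cs)) + length cs) [[]; []] [] 0 0 cs)
    as (K & HK & HF); auto; try easy.
  - repeat split; simpl; auto.
    + repeat (apply Forall_cons || apply Forall_nil); now apply n_out_0_admissible.
    + exists [(gone, gone); (gone, gone)]. split; auto. unfold conj_prod. simpl. group.
      apply prod_gens_one.
  - unfold cs. apply Forall_app. split; rewrite Forall_map.
    + revert HT. apply Forall_impl. intros t. apply tri_cell.
    + revert HA. apply Forall_impl. intros t. apply cap_cell.
  - intros h. simpl. rewrite Hc1, edge_sum_app.
    change (edge_sum (concat (map tri_word T)) h) with (tri_bd T h).
    rewrite Hbd. clear. induction A as [|a A IH]; simpl; [lra|]. rewrite sign_negb. lra.
  (* With t triangles and a caps the bound reads 4K + 2(t + a) <= 3t + a + 2a. *)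
  - rewrite Hc2 in *. rewrite Hc1 in *. exists K. split; auto. simpl in HF.
    unfold cs in HF. rewrite !length_app, !length_map in *. lia.
Qed.

Lemma is_int_plus x y : is_int x -> is_int y -> is_int (x + y).
Proof. intros [a ->] [b ->]. exists (a + b)%Z. now rewrite plus_IZR. Qed.

Lemma is_int_opp x : is_int x -> is_int (- x).
Proof. intros [a ->]. exists (- a)%Z. now rewrite opp_IZR. Qed.

Lemma is_int_mult x y : is_int x -> is_int y -> is_int (x * y).
Proof. intros [a ->] [b ->]. exists (a * b)%Z. now rewrite mult_IZR. Qed.

Lemma is_int_delta (g h : G) : is_int (delta g h).
Proof. unfold delta. destruct (excluded_middle_informative _); [now exists 1%Z|now exists 0%Z]. Qed.

Lemma is_int_sign b : is_int (sign b).
Proof. destruct b; [now exists 1%Z|now exists (-1)%Z]. Qed.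

Lemma is_int_lt_1 x : is_int x -> (Rabs x < 1)%R -> x = 0%R.
Proof.
  intros [z ->] H. apply Rabs_def2 in H. destruct H as [H1 H2].
  apply lt_IZR in H1. change (-1)%R with (IZR (-1)) in H2.
  replace (- (1))%R with (IZR (-1)) in H2 by (simpl; lra). apply lt_IZR in H2.
  f_equal. lia.
Qed.

Lemma bd2_int (L : list (R * (G * G))) h :
  Forall (fun p => is_int (fst p)) L -> is_int (bd2 L h).
Proof.
  induction 1 as [|p L Hp HL IH]; simpl; [now exists 0%Z|].
  apply is_int_plus; auto. apply is_int_mult; auto. unfold Rminus.
  repeat first [apply is_int_plus | apply is_int_opp | apply is_int_delta].
Qed.

Lemma edge_sum_int A h : is_int (edge_sum A h).
Proof.
  induction A as [|a A IH]; simpl; [now exists 0%Z|].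
  apply is_int_plus; auto. apply is_int_mult; [apply is_int_sign|apply is_int_delta].
Qed.

(** A coefficient z becomes |z| copies of its triangle, oriented by the sign of z. *)
Lemma triangles_of_int (L : list (R * (G * G))) :
  Forall (fun p => is_int (fst p)) L -> in_C2' N L ->
  exists T, Forall (fun t => in_tri (snd t)) T /\ (forall h, tri_bd T h = bd2 L h) /\
    INR (length T) = l1 L.
Proof.
  induction L as [|[r t] L IH]; intros H1 H2.
  - exists []. repeat split; auto.
  - inversion_clear H1 as [|? ? [z Hz] HL]. inversion_clear H2 as [|? ? Ht HL']. simpl in Hz, Ht.
    destruct (IH HL HL') as (T & HT & Hbd & Hlen). clear IH.
    set (b := Z.leb 0 z).
    assert (Hb : r = (sign b * INR (Z.abs_nat z))%R /\ Rabs r = INR (Z.abs_nat z)).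
    { rewrite Hz. rewrite INR_IZR_INZ, Zabs2Nat.id_abs. unfold b, sign.
      destruct (Z.leb_spec 0 z) as [Hle|Hlt].
      - rewrite Z.abs_eq by auto. split; [lra|]. apply Rabs_pos_eq. now apply IZR_le.
      - rewrite Z.abs_neq, opp_IZR by lia. split; [lra|]. apply Rabs_left. now apply IZR_lt. }
    destruct Hb as [Hr Ha]. exists (repeat (b, t) (Z.abs_nat z) ++ T). repeat split.
    + apply Forall_app. split; auto. apply Forall_forall. intros u Hu.
      apply repeat_spec in Hu. now subst u.
    + intros h. simpl. rewrite <- Hbd, Hr. clear. induction (Z.abs_nat z) as [|n IH].
      * simpl. lra.
      * cbn [repeat app]. rewrite tri_bd_cons, IH, S_INR. simpl. lra.
    + rewrite length_app, repeat_length, plus_INR, Hlen. simpl. now rewrite Ha.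
Qed.

(** ** Simultaneous Diophantine approximation *)

(** Pigeonhole: the fractional parts of 0, x, ..., nx fall into n intervals of length 1/n, indexed
    by [f]; two in the same interval give j as a difference. *)
Lemma dirichlet (x : R) (n : nat) : (0 < n)%nat ->
  exists j z, (1 <= j <= n)%nat /\ (Rabs (INR j * x - IZR z) <= / INR n)%R.
Proof.
  intros Hn. assert (Hn' : (0 < INR n)%R) by now apply lt_0_INR.
  set (f := fun i => Z.to_nat (Int_part (INR n * frac_part (INR i * x)))).
  assert (Hf : forall i, (INR (f i) <= INR n * frac_part (INR i * x) < INR (f i) + 1)%R
    /\ (f i < n)%nat).
  { intros i. unfold f. set (y := (INR n * frac_part (INR i * x))%R).
    destruct (base_fp (INR i * x)) as [Hp1 Hp2]. apply Rge_le in Hp1.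
    assert (Hy : (0 <= y < INR n)%R).
    { unfold y. split; [apply Rmult_le_pos; lra|].
      rewrite <- (Rmult_1_r (INR n)) at 2. now apply Rmult_lt_compat_l. }
    destruct (base_Int_part y) as [Hi1 Hi2].
    assert (Hz : (0 <= Int_part y)%Z).
    { cut (-1 < Int_part y)%Z; [lia|]. apply lt_IZR. lra. }
    rewrite INR_IZR_INZ, Z2Nat.id by auto. split; [lra|].
    apply INR_lt. rewrite INR_IZR_INZ, Z2Nat.id by auto. lra. }
  assert (Hex : exists i j, (i < j <= n)%nat /\ f i = f j).
  { apply NNPP. intros Hno.
    assert (Hnd : NoDup (map f (seq 0 (S n)))).
    { apply NoDup_map_NoDup_ForallPairs; [|apply seq_NoDup].
      intros i j Hi Hj Hij. apply in_seq in Hi, Hj.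
      destruct (Nat.lt_trichotomy i j) as [Hlt|[He|Hlt]]; auto; exfalso; apply Hno.
      - exists i, j. split; [lia|auto].
      - exists j, i. split; [lia|auto]. }
    apply (NoDup_incl_length (l' := seq 0 n)) in Hnd.
    - rewrite length_map, !length_seq in Hnd. lia.
    - intros y Hy. apply in_map_iff in Hy. destruct Hy as (i & <- & _).
      apply in_seq. destruct (Hf i). lia. }
  destruct Hex as (i & j & Hij & He).
  exists (j - i)%nat, (Int_part (INR j * x) - Int_part (INR i * x))%Z. split; [lia|].
  rewrite minus_INR by lia. rewrite minus_IZR.
  destruct (Hf i) as [Hi _], (Hf j) as [Hj _]. rewrite He in Hi. unfold frac_part in *.
  apply (Rmult_le_reg_l (INR n)); auto. rewrite Rinv_r by lra.
  rewrite <- (Rabs_pos_eq (INR n)) at 1 by lra. rewrite <- Rabs_mult.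
  apply Rabs_le. split; nra.
Qed.

(** The tail is first approximated within eps/n; Dirichlet for the head then multiplies by some j <=
    n, which raises the tail errors to at most eps. *)
Lemma simultaneous_approximation (rs : list R) (eps : R) : (0 < eps)%R ->
  exists M, (1 <= M)%nat /\ Forall (fun a => exists z, Rabs (INR M * a - IZR z) <= eps)%R rs.
Proof.
  revert eps. induction rs as [|a rs IH]; intros eps Heps.
  - exists 1%nat. split; auto.
  - destruct (nfloor_ex (/ eps)) as [m Hm]; [left; now apply Rinv_0_lt_compat|].
    set (n := S m). assert (Hn : (/ INR n <= eps)%R).
    { rewrite <- (Rinv_inv eps). apply Rinv_le_contravar; [now apply Rinv_0_lt_compat|].
      unfold n. rewrite S_INR. lra. }
    assert (Hn0 : (0 < INR n)%R) by (apply lt_0_INR; unfold n; lia).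
    destruct (IH (eps / INR n)%R) as (M & HM & HF); [now apply Rdiv_lt_0_compat|].
    destruct (dirichlet (INR M * a) n) as (j & z & Hj & Hz); [unfold n; lia|].
    exists (j * M)%nat. split; [nia|]. constructor.
    + exists z. rewrite mult_INR, Rmult_assoc. lra.
    + revert HF. apply Forall_impl. intros b (y & Hy). exists (Z.of_nat j * y)%Z.
      rewrite mult_INR, mult_IZR, <- INR_IZR_INZ.
      replace (INR j * INR M * b - INR j * IZR y)%R with (INR j * (INR M * b - IZR y))%R by ring.
      rewrite Rabs_mult, (Rabs_pos_eq (INR j)) by apply pos_INR.
      apply Rle_trans with (INR n * (eps / INR n))%R.
      * apply Rmult_le_compat; auto; try apply pos_INR; try apply Rabs_pos. apply le_INR; lia.
      * right. field. lra.
Qed.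

(* The boundary of an approximately integral multiple of a filling of an integral chain
   differs from a multiple of that chain by less than 1, hence not at all. *)
Lemma integral_filling (L : list (R * (G * G))) A :
  in_C2' N L -> (forall h, bd2 L h = edge_sum A h) ->
  exists M T, (1 <= M)%nat /\ Forall (fun t => in_tri (snd t)) T /\
    (forall h, tri_bd T h = INR M * edge_sum A h)%R /\
    (INR (length T) <= INR M * l1 L + 1)%R.
Proof.
  intros HL Hbd.
  set (d := INR (length L)). assert (Hd : (0 <= d)%R) by apply pos_INR.
  (* Rounding d coefficients by eps each moves a boundary coefficient by at most 3 d eps, as a
     triangle has three edges, and the norm by at most d eps; both are below 1. *)
  set (eps := (/ (3 * d + 1))%R). assert (Heps : (0 < eps)%R) by (apply Rinv_0_lt_compat; lra).
  assert (Hde : (3 * d * eps < 1)%R).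
  { apply Rmult_lt_reg_r with (3 * d + 1)%R; [lra|]. unfold eps.
    rewrite Rmult_assoc, Rinv_l by lra. lra. }
  destruct (simultaneous_approximation (map fst L) eps Heps) as (M & HM & HF).
  assert (HL' : exists L', Forall (fun p => is_int (fst p)) L' /\ in_C2' N L' /\
    (forall h, Rabs (bd2 L' h - INR M * bd2 L h) <= 3 * d * eps)%R /\
    (l1 L' <= INR M * l1 L + d * eps)%R).
  { clear - HL HF Heps. clearbody eps. unfold d. clear d. induction L as [|[r t] L IH].
    - exists []. repeat split; auto; simpl; try lra. intros h.
      replace (0 - INR M * 0)%R with 0%R by ring. rewrite Rabs_R0. lra.
    - inversion_clear HL as [|? ? Ht HL']. simpl in HF.
      pose proof (Forall_inv HF) as (z & Hz). apply Forall_inv_tail in HF.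
      destruct (IH HL' HF) as (L' & H1 & H2 & H3 & H4). exists ((IZR z, t) :: L').
      cbn [length]. rewrite S_INR. simpl in Hz. apply Rabs_le_between in Hz. repeat split.
      + constructor; auto. now exists z.
      + constructor; auto.
      + intros h. specialize (H3 h). apply Rabs_le_between in H3. simpl.
        set (u := (delta (snd t) h - delta (gmul (fst t) (snd t)) h + delta (fst t) h)%R).
        assert (Hu : (-3 <= u <= 3)%R).
        { unfold u, delta. repeat destruct (excluded_middle_informative _); lra. }
        apply Rabs_le. split; nra.
      + simpl. assert (Rabs (IZR z) <= INR M * Rabs r + eps)%R; [|lra].
        rewrite <- (Rabs_pos_eq (INR M)) by apply pos_INR. rewrite <- Rabs_mult.
        unfold Rabs. repeat destruct (Rcase_abs _); lra. }
  destruct HL' as (L' & H1 & H2 & H3 & H4).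
  destruct (triangles_of_int L' H1 H2) as (T & HT & HTb & HTl).
  exists M, T. repeat split; auto.
  - intros h. rewrite HTb, <- Hbd.
    assert (bd2 L' h - INR M * bd2 L h = 0)%R; [|lra]. apply is_int_lt_1.
    + unfold Rminus. apply is_int_plus; [now apply bd2_int|]. apply is_int_opp, is_int_mult.
      * exists (Z.of_nat M). apply INR_IZR_INZ.
      * rewrite Hbd. apply edge_sum_int.
    + apply Rle_lt_trans with (3 * d * eps)%R; auto.
  - rewrite HTl. nra.
Qed.


(** ** Fillings bounded by commutator length *)

Local Open Scope R_scope.

(** Pairs may repeat and [r] is only an upper bound, so fillings add by concatenation. Collecting
    equal pairs later does not increase the norm. *)
Definition fills (c : chain1 G) (r : R) : Prop :=
  exists L, in_C2' N L /\ (forall h, bd2 L h = c h) /\ l1 L <= r.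

Lemma bd2_app (L L' : list (R * (G * G))) h : bd2 (L ++ L') h = bd2 L h + bd2 L' h.
Proof. induction L as [|p L IH]; simpl; [lra|]. rewrite IH. lra. Qed.

Lemma l1_app (L L' : list (R * (G * G))) : l1 (L ++ L') = l1 L + l1 L'.
Proof. induction L as [|p L IH]; simpl; [lra|]. rewrite IH. lra. Qed.

Lemma fills_add c c' d r r' s : (forall h, d h = c h + c' h) -> r + r' <= s ->
  fills c r -> fills c' r' -> fills d s.
Proof.
  intros Hd Hs (L & H1 & H2 & H3) (L' & H1' & H2' & H3'). exists (L ++ L'). repeat split.
  - now apply Forall_app.
  - intros h. now rewrite bd2_app, H2, H2', Hd.
  - rewrite l1_app. lra.
Qed.

Lemma fills_opp c d r : (forall h, d h = - c h) -> fills c r -> fills d r.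
Proof.
  intros Hd (L & H1 & H2 & H3). exists (map (fun p => (- fst p, snd p)) L). repeat split.
  - unfold in_C2'. rewrite Forall_map. exact H1.
  - intros h. rewrite Hd, <- H2. clear. induction L as [|p L IH]; simpl; [lra|]. rewrite IH. lra.
  - replace (l1 (map _ L)) with (l1 L); auto. clear.
    induction L as [|p L IH]; simpl; auto. now rewrite Rabs_Ropp, IH.
Qed.

Lemma fills_ext c d r s : (forall h, d h = c h) -> r <= s -> fills c r -> fills d s.
Proof.
  intros Hd Hs (L & H1 & H2 & H3). exists L. repeat split; auto; [|lra].
  intros h. now rewrite Hd.
Qed.

Lemma fills_tri x y : N x \/ N y ->
  fills (fun h => delta y h - delta (gmul x y) h + delta x h) 1.
Proof.
  intros H. exists [(1, (x, y))]. repeat split.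
  - constructor; [exact H|constructor].
  - intros h. simpl. lra.
  - simpl. rewrite Rabs_R1. lra.
Qed.

Lemma fills_one : fills (delta gone) 1.
Proof.
  eapply fills_ext; [| |apply (fills_tri gone gone)]; [|lra|left; apply (ns_one _ _ HN)].
  intros h. simpl. rewrite gmul_1l. lra.
Qed.

Lemma fills_inv x : N x -> fills (fun h => delta x h + delta (ginv x) h) 2.
Proof.
  intros H. eapply fills_add; [| |apply (fills_tri x (ginv x)); now left|apply fills_one]; [|lra].
  intros h. simpl. rewrite gmul_Vr. lra.
Qed.

(** The triangles (gxg^{-1}, g) and (g, x) share the product gx and the edge g. *)
Lemma fills_conj g x : N x -> fills (fun h => delta (conj g x) h - delta x h) 2.
Proof.
  intros H.
  eapply fills_add; [| |apply (fills_tri (conj g x) g); left; now apply conj_N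
    |eapply fills_opp; [reflexivity|apply (fills_tri g x); now right]]; [|lra].
  intros h. simpl. replace (gmul (conj g x) g) with (gmul g x) by group. lra.
Qed.

(** As [g,x]x = gxg^{-1}, one triangle reduces to the filling of a conjugation. *)
Lemma fills_comm g x : N x -> fills (delta (comm g x)) 3.
Proof.
  intros H.
  eapply fills_add; [| |apply (fills_tri (comm g x) x); now right|apply (fills_conj g x H)]; [|lra].
  intros h. simpl. replace (gmul (comm g x) x) with (conj g x) by group. lra.
Qed.

Lemma fills_comm_inv g x : N x -> fills (delta (ginv (comm g x))) 3.
Proof.
  intros H.
  eapply fills_add; [| |apply (fills_tri (ginv (comm g x)) (conj g x)); right; now apply conj_N
    |eapply fills_opp; [reflexivity|apply (fills_conj g x H)]]; [|lra].
  intros h. simpl. replace (gmul (ginv (comm g x)) (conj g x)) with x by group. lra.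
Qed.

Lemma comm_N g x : N x -> N (comm g x).
Proof. intros H. apply (ns_mul _ _ HN); [now apply conj_N|now apply (ns_inv _ _ HN)]. Qed.

Lemma fills_mul x y r s : N x -> fills (delta x) r -> fills (delta y) s ->
  fills (delta (gmul x y)) (r + s + 1).
Proof.
  intros H Hx Hy.
  eapply fills_add; [| |eapply fills_add; [reflexivity| |exact Hx|exact Hy]
    |eapply fills_opp; [reflexivity|apply (fills_tri x y); now left]].
  - intros h. simpl. lra.
  - apply Rle_refl.
  - apply Rle_refl.
Qed.

(** Per factor, three triangles fill the commutator and one multiplies it in; the last 1 fills the
    identity. *)
Lemma fills_prod_gens w k : is_prod_gens N w k -> fills (delta w) (4 * INR k + 1).
Proof.
  intros (l & <- & Hf & ->). induction l as [|[[g x] b] l IH].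
  - eapply fills_ext; [reflexivity| |apply fills_one]. simpl. lra.
  - inversion_clear Hf as [|? ? Hx Hl]. specialize (IH Hl).
    cbn [length map gprod fold_right]. rewrite S_INR.
    eapply fills_ext; [reflexivity| |apply fills_mul; [| |exact IH]].
    + instantiate (1 := 3). lra.
    + destruct b; [|apply (ns_inv _ _ HN)]; now apply comm_N.
    + destruct b; [now apply fills_comm|now apply fills_comm_inv].
Qed.

Lemma fills_conj_prod l : Forall N (map snd l) ->
  fills (fun h => edge_sum (map (pair true) (map snd l)) h - delta (conj_prod l) h)
    (3 * INR (length l) + 1).
Proof.
  induction l as [|[g x] l IH]; intros H.
  - eapply fills_opp; [|eapply fills_ext; [reflexivity| |apply fills_one]].
    + intros h. simpl. change (conj_prod []) with (@gone G). lra.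
    + simpl. lra.
  - inversion_clear H as [|? ? Hx Hl]. simpl in Hx. specialize (IH Hl).
    cbn [length]. rewrite S_INR.
    eapply fills_add; [| |exact IH|eapply fills_add; [reflexivity| |
      apply (fills_tri (conj g x) (conj_prod l)); left; now apply conj_N
      |eapply fills_opp; [reflexivity|apply (fills_conj g x Hx)]]].
    + intros h. simpl. rewrite conj_prod_cons. lra.
    + instantiate (1 := 3). lra.
    + lra.
Qed.

(** Each letter costs 2 for replacing a negative letter by an inverse, 2 for conjugation and 1 for
    multiplication; the constant 2 pays for two identities. *)
Lemma Fill_fills A K : Forall (fun a => N (snd a)) A -> Fill (map lval A) K ->
  fills (edge_sum A) (4 * INR K + 5 * INR (length A) + 2).
Proof.
  intros HA (l & Hl & Hp).
  assert (Hlv : fills (fun h => edge_sum A h - edge_sum (map (pair true) (map lval A)) h)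
    (2 * INR (length A))).
  { clear Hl Hp. induction A as [|a A IH].
    - exists []. split; [constructor|split; [intros h|]; simpl; lra].
    - inversion_clear HA as [|? ? Ha HA']. cbn [length]. rewrite S_INR.
      eapply fills_add; [| |apply IH; auto|].
      2: instantiate (1 := 2); lra.
      2:{ instantiate (1 := fun h => sign (fst a) * delta (snd a) h - delta (lval a) h).
          destruct a as [[|] x]; unfold lval; simpl.
          (* A positive letter leaves the zero chain, filled by a cancelling pair to share the bound
             2. *)
          - eapply fills_add; [| |apply fills_one|eapply fills_opp; [reflexivity|apply fills_one]].
            + intros h. simpl. lra.
            + lra.
          - eapply fills_opp; [|now apply (fills_inv x)]. intros h. simpl. lra. }
      intros h. simpl. lra. }
  assert (HN' : Forall N (map snd l)).
  { rewrite Hl. rewrite Forall_map. revert HA. apply Forall_impl.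
    intros [[|] x] Hx; unfold lval; simpl in *; auto. now apply (ns_inv _ _ HN). }
  eapply fills_add; [| |exact Hlv|eapply fills_add; [reflexivity| |
    apply (fills_conj_prod l HN')|apply (fills_prod_gens _ _ Hp)]].
  - intros h. simpl. rewrite (edge_sum_perm (map (pair true) (map snd l)) (map (pair true) (map lval A))).
    + lra.
    + now apply Permutation_map.
  - instantiate (1 := 4 * INR K + 3 * INR (length A) + 2). lra.
  - replace (length l) with (length A); [lra|].
    apply Permutation_length in Hl. rewrite !length_map in Hl. auto.
Qed.

(** * Infima defining the norm and the commutator length *)

Lemma fills_NoDup (L : list (R * (G * G))) : in_C2' N L ->
  exists L', NoDup (map snd L') /\ in_C2' N L' /\ (forall h, bd2 L' h = bd2 L h) /\ l1 L' <= l1 L.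
Proof.
  induction L as [|[r t] L IH]; intros H.
  - exists []. repeat split; [constructor|constructor|apply Rle_refl].
  - inversion_clear H as [|? ? Ht HL]. destruct (IH HL) as (L' & H1 & H2 & H3 & H4).
    destruct (classic (In t (map snd L'))) as [Hin|Hin].
    + apply in_map_iff in Hin. destruct Hin as ([s t'] & He & Hin). simpl in He. subst t'.
      apply in_split in Hin. destruct Hin as (l1' & l2' & ->).
      exists (l1' ++ (r + s, t) :: l2'). repeat split.
      * rewrite map_app in *. exact H1.
      * unfold in_C2' in *. rewrite Forall_app in *. destruct H2 as [H2 H2'].
        split; auto. inversion_clear H2'. now constructor.
      * intros h. simpl. rewrite <- H3, !bd2_app. simpl. lra.
      * simpl. rewrite !l1_app in *. simpl in *. pose proof (Rabs_triang r s). lra.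
    + exists ((r, t) :: L'). repeat split.
      * now constructor.
      * now constructor.
      * intros h. simpl. now rewrite H3.
      * simpl. lra.
Qed.

Lemma l1_pos (L : list (R * (G * G))) : 0 <= l1 L.
Proof. induction L as [|p L IH]; simpl; [lra|]. pose proof (Rabs_pos (fst p)). lra. Qed.

(** A nonempty set of nonnegative reals has a finite infimum, so [real] returns its true value. *)
Lemma Glb_Rbar_approx (E : R -> Prop) x : E x -> (forall y, E y -> 0 <= y) ->
  (forall y, E y -> real (Glb_Rbar E) <= y) /\
  (forall eps, 0 < eps -> exists y, E y /\ y < real (Glb_Rbar E) + eps).
Proof.
  intros Hx Hpos. destruct (Glb_Rbar_correct E) as [H1 H2].
  assert (H0 : Rbar_le 0 (Glb_Rbar E)) by (apply H2; intros y Hy; now apply Hpos).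
  pose proof (H1 _ Hx) as Hgx.
  destruct (Glb_Rbar E) as [g| |]; simpl in *; try easy. split.
  - intros y Hy. now apply (H1 y).
  - intros eps Heps. apply NNPP. intros Hno.
    assert (Hc : Rbar_le (g + eps) g).
    { apply H2. intros y Hy. simpl. apply Rnot_lt_le. intros Hlt. apply Hno. now exists y. }
    simpl in Hc. lra.
Qed.

(** The infimum is approached within 1, a slack that disappears after division by n. *)
Lemma normp_spec c r : fills c r -> normp N c <= r /\ fills c (normp N c + 1).
Proof.
  intros (L & H1 & H2 & H3). destruct (fills_NoDup L H1) as (L' & H1' & H2' & H3' & H4').
  unfold normp.
  match goal with |- real (Glb_Rbar ?E) <= _ /\ _ => destruct (Glb_Rbar_approx E (l1 L')) as [Hle Hex] end.
  - exists L'. repeat split; auto. intros h. now rewrite H3'.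
  - intros y (L0 & _ & _ & _ & ->). apply l1_pos.
  - split.
    + apply Rle_trans with (l1 L'); [|lra]. apply Hle. exists L'. repeat split; auto.
      intros h. now rewrite H3'.
    + destruct (Hex 1) as (y & (L0 & _ & HC & Hb & ->) & Hy); [lra|].
      exists L0. repeat split; auto. lra.
Qed.

Lemma Glb_Rbar_nat (P : nat -> Prop) k : P k ->
  exists k0, P k0 /\ (forall k', P k' -> (k0 <= k')%nat) /\
    real (Glb_Rbar (fun r => exists k, P k /\ r = INR k)) = INR k0.
Proof.
  intros Hk. destruct (dec_inh_nat_subset_has_unique_least_element P) as (k0 & [H0 Hmin] & _).
  - intros n. apply classic.
  - now exists k.
  - exists k0. repeat split; auto.
    rewrite (is_glb_Rbar_unique _ (Finite (INR k0))); auto. split.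
    + intros x (k' & Hk' & ->). simpl. apply le_INR. auto.
    + intros b Hb. apply Hb. now exists k0.
Qed.

(** Both nested infima run over nonempty sets of naturals, so they are attained and the chain length
    is the least genus. *)
Lemma cl_chain_spec zs K : Forall N zs -> Fill zs K ->
  exists K0, cl_chain N zs = INR K0 /\ Fill zs K0 /\ forall K', Fill zs K' -> (K0 <= K')%nat.
Proof.
  intros HF HK.
  set (P := fun k => exists gs, length gs = pred (length zs) /\ cl N (conj_word zs gs) = INR k).
  assert (Hcl : forall gs, length gs = pred (length zs) -> exists k,
    cl N (conj_word zs gs) = INR k /\ is_prod_gens N (conj_word zs gs) k /\
    forall k', is_prod_gens N (conj_word zs gs) k' -> (k <= k')%nat).
  { intros gs Hgs. destruct (Fill_every_conj_word zs gs K HF Hgs HK) as (K' & HK').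
    destruct (Glb_Rbar_nat (is_prod_gens N (conj_word zs gs)) K' HK') as (k & H1 & H2 & H3).
    exists k. repeat split; auto. }
  assert (Hle : forall K', Fill zs K' -> exists k, P k /\ (k <= K')%nat).
  { intros K' HK'. apply Fill_conj_word in HK'. destruct HK' as (gs & Hgs & Hp).
    destruct (Hcl gs Hgs) as (k & H1 & H2 & H3). exists k. split; auto. now exists gs. }
  destruct (Hle K HK) as (k & Hk & _).
  destruct (Glb_Rbar_nat P k Hk) as (k0 & (gs & Hgs & Hk0) & Hmin & Hg).
  exists k0. repeat split.
  - rewrite <- Hg. unfold cl_chain. f_equal. apply Glb_Rbar_eqset. intros r. split.
    + intros (gs' & Hgs' & ->). destruct (Hcl gs' Hgs') as (k' & Hk' & _).
      exists k'. split; auto. now exists gs'.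
    + intros (k' & (gs' & Hgs' & Hk') & ->). now exists gs'.
  - destruct (Hcl gs Hgs) as (k' & H1 & H2 & _).
    apply conj_word_Fill with gs; auto. rewrite H1 in Hk0. apply INR_eq in Hk0. now subst k'.
  - intros K' HK'. destruct (Hle K' HK') as (k' & Hk' & Hl). apply Hmin in Hk'. lia.
Qed.

(** ** Powers *)

(** For each z, one handle merges the loops z^a and z^b into z^{a+b}. *)
Lemma Fill_pow_add zs a b hs K : Forall N zs ->
  Fill (map (fun z => gpow z a) zs ++ map (fun z => gpow z b) zs ++ hs) K ->
  Fill (map (fun z => gpow z (a + b)) zs ++ hs) (K + length zs).
Proof.
  revert hs K. induction zs as [|z zs IH]; intros hs K HF H; simpl in *.
  - now rewrite Nat.add_0_r.
  - inversion_clear HF as [|? ? Hz Hzs].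
    apply (Fill_perm (map (fun z => gpow z (a + b)) zs ++ gpow z (a + b) :: hs)).
    { symmetry. apply Permutation_middle. }
    rewrite <- Nat.add_succ_comm. apply IH; auto.
    apply (Fill_perm (gpow z (a + b) :: map (fun z => gpow z a) zs ++ map (fun z => gpow z b) zs ++ hs)).
    { rewrite !app_assoc. apply Permutation_middle. }
    rewrite gpow_add. apply Fill_handle; [now apply gpow_N|].
    revert H. apply Fill_perm. constructor. symmetry. apply Permutation_middle.
Qed.

Lemma Fill_pow_repeat zs n M K : Forall N zs ->
  Fill (concat (repeat (map (fun z => gpow z n) zs) M)) K ->
  Fill (map (fun z => gpow z (n * M)) zs) (K + M * length zs).
Proof.
  intros HF H.
  assert (Hg : forall M hs K, Fill (concat (repeat (map (fun z => gpow z n) zs) M) ++ hs) K ->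
    Fill (map (fun z => gpow z (n * M)) zs ++ hs) (K + M * length zs)).
  { clear H. intros M'. induction M' as [|M' IH]; intros hs K' H; simpl in *.
    (* With no copies the loops z^0 are trivial and added for free; starting here gives the count M,
       not M - 1. *)
    - rewrite Nat.mul_0_r, Nat.add_0_r. revert H. clear. generalize hs as hs'.
      intros hs' (l & Hl & Hp).
      exists (map (fun z => (gone, gone)) zs ++ l). split.
      + rewrite map_app, map_map. simpl. now apply Permutation_app_head.
      + rewrite conj_prod_app. replace (conj_prod (map _ zs)) with (@gone G); [now rewrite gmul_1l|].
        clear. induction zs as [|z zs IH]; auto. simpl. rewrite conj_prod_cons, <- IH. group.
    - rewrite <- app_assoc in H.
      apply (Fill_perm _ (concat (repeat (map (fun z => gpow z n) zs) M') ++
        map (fun z => gpow z n) zs ++ hs)) in H.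
      2:{ rewrite !app_assoc. apply Permutation_app_tail, Permutation_app_comm. }
      apply IH in H. apply Fill_pow_add in H; auto.
      replace (n * S M')%nat with (n * M' + n)%nat by lia.
      revert H. apply Fill_le. lia. }
  specialize (Hg M [] K). rewrite !app_nil_r in Hg. auto.
Qed.

End MixedCommutators.

(** * Limits of subadditive sequences *)

Lemma fekete (b : nat -> R) : (forall n, 0 <= b n) -> (forall n m, b (n + m)%nat <= b n + b m) ->
  exists s : R, is_lim_seq (fun n => b (S n) / INR (S n)) s /\ (forall n, s * INR n <= b n).
Proof.
  intros Hpos Hsub.
  set (E := fun r => exists n, r = b (S n) / INR (S n)).
  assert (HS : forall n, 0 < INR (S n)) by (intros; apply lt_0_INR; lia).
  destruct (Glb_Rbar_approx E (b 1%nat / INR 1)) as [Hle Hex].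
  - now exists 0%nat.
  - intros y (n & ->). apply Rdiv_le_0_compat; auto.
  - set (s := real (Glb_Rbar E)) in *. exists s. split.
    2:{ intros [|n]; [simpl; specialize (Hpos 0%nat); lra|].
        apply Rmult_le_reg_r with (/ INR (S n)); [now apply Rinv_0_lt_compat|].
        rewrite Rmult_assoc, Rinv_r, Rmult_1_r by (specialize (HS n); lra).
        apply Hle. now exists n. }
    assert (Hlin : forall q d r, b (q * d + r)%nat <= INR q * b d + b r).
    { intros q d r. induction q as [|q IH]; [simpl; lra|].
      rewrite S_INR. replace (S q * d + r)%nat with (d + (q * d + r))%nat by lia.
      specialize (Hsub d (q * d + r)%nat). lra. }
    apply is_lim_seq_spec. intros eps.
    (* [S d] realises the infimum up to eps/2; S n is then divided by it with remainder. *)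
    destruct (Hex (eps / 2)) as (y & (d & ->) & Hd); [destruct eps; simpl; lra|].
    (* [B] bounds the value of [b] at every remainder r below [S d], through r copies of [b 1] and
       one [b 0]. *)
    set (B := INR (S d) * b 1%nat + b 0%nat).
    assert (HB : 0 <= B).
    { unfold B. specialize (HS d). pose proof (Hpos 0%nat). pose proof (Hpos 1%nat). nra. }
    destruct (nfloor_ex (B / (eps / 2))) as [n0 Hn0].
    { apply Rdiv_le_0_compat; auto. destruct eps; simpl; lra. }
    exists n0. intros n Hn. specialize (HS n).
    assert (H1 : s <= b (S n) / INR (S n)) by (apply Hle; now exists n).
    rewrite Rabs_pos_eq by lra.
    assert (H2 : b (S n) <= (b (S d) / INR (S d)) * INR (S n) + B).
    { pose proof (Nat.div_mod_eq (S n) (S d)) as Hdm.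
      pose proof (Nat.mod_upper_bound (S n) (S d)) as Hmod.
      set (q := (S n / S d)%nat) in *. set (r := (S n mod S d)%nat) in *.
      rewrite Hdm at 1. rewrite Nat.mul_comm.
      eapply Rle_trans; [apply Hlin|]. apply Rplus_le_compat.
      - assert (Hq : INR q * INR (S d) <= INR (S n)) by (rewrite <- mult_INR; apply le_INR; lia).
        assert (Hd0 : 0 < INR (S d)) by (apply lt_0_INR; lia).
        replace (INR q * b (S d)) with (b (S d) / INR (S d) * (INR q * INR (S d))) by (field; lra).
        apply Rmult_le_compat_l; auto. apply Rdiv_le_0_compat; auto.
      - specialize (Hlin r 1%nat 0%nat). rewrite Nat.mul_1_r, Nat.add_0_r in Hlin.
        eapply Rle_trans; [apply Hlin|]. unfold B. apply Rplus_le_compat_r.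
        apply Rmult_le_compat_r; auto. apply le_INR. lia. }
    assert (He : 0 < eps / 2) by (destruct eps; simpl; lra).
    assert (H3 : B < INR (S n) * (eps / 2)).
    { apply Rmult_lt_reg_r with (/ (eps / 2)); [now apply Rinv_0_lt_compat|].
      rewrite Rmult_assoc, Rinv_r, Rmult_1_r by lra.
      apply Rlt_le_trans with (INR n0 + 1); [apply Hn0|]. rewrite <- S_INR. apply le_INR. lia. }
    apply Rlt_le_trans with (s + eps / 2 + eps / 2 - s); [|lra]. unfold Rminus.
    apply Rplus_lt_compat_r. apply Rmult_lt_reg_r with (INR (S n)); auto.
    unfold Rdiv at 1. rewrite Rmult_assoc, Rinv_l, Rmult_1_r by lra. nra.
Qed.

Lemma is_lim_seq_const_over_n (C : R) : is_lim_seq (fun n => C / INR (S n)) 0.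
Proof.
  apply (is_lim_seq_incr_1 (fun n => C / INR n)).
  apply (is_lim_seq_div _ _ C p_infty); try easy.
  - apply is_lim_seq_const.
  - apply is_lim_seq_INR.
  - unfold is_Rbar_div, is_Rbar_mult. simpl. now rewrite Rmult_0_r.
Qed.

(** Here [a] stands for the commutator length and [f] for the norm of n-th powers. Fekete for a + C
    gives s n <= a n + C; at nM, divided by M, this becomes 4 s n <= f n + 5C, which with the upper
    bound squeezes f. *)
Lemma quasi_proportional_limits (a f : nat -> R) (C : R) :
  (forall n, 0 <= a n) -> 0 <= C ->
  (forall n m, a (n + m)%nat <= a n + a m + C) ->
  (forall n, f n <= 4 * a n + C) ->
  (forall n, exists M, (1 <= M)%nat /\ 4 * a (n * M)%nat <= INR M * (f n + C)) ->
  exists s : R, is_lim_seq (fun n => a (S n) / INR (S n)) s /\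
    is_lim_seq (fun n => f (S n) / INR (S n)) (4 * s)%R.
Proof.
  intros Ha HC Hsub Hfa Haf.
  destruct (fekete (fun n => a n + C)) as (s & Hlim & Hs).
  - intros n. specialize (Ha n). lra.
  - intros n m. specialize (Hsub n m). lra.
  - assert (HS : forall n, 0 < INR (S n)) by (intros; apply lt_0_INR; lia).
    assert (Hla : is_lim_seq (fun n => a (S n) / INR (S n)) s).
    { replace s with (s - 0) by ring.
      eapply is_lim_seq_ext; [|apply (is_lim_seq_minus' _ _ _ _ Hlim (is_lim_seq_const_over_n C))].
      intros n. simpl. specialize (HS n). simpl in HS. field. lra. }
    exists s. split; auto.
    apply (is_lim_seq_le_le (fun n => 4 * s - (5 * C) / INR (S n)) _
      (fun n => 4 * (a (S n) / INR (S n)) + C / INR (S n))).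
    + intros n. specialize (HS n). split.
      * apply Rmult_le_reg_r with (INR (S n)); auto.
        unfold Rdiv. rewrite Rmult_minus_distr_r, !(Rmult_assoc _ (/ _)), Rinv_l, !Rmult_1_r by lra.
        destruct (Haf (S n)) as (M & HM & HMf). specialize (Hs (S n * M)%nat).
        rewrite mult_INR in Hs. assert (HM' : 1 <= INR M) by (apply (le_INR 1); auto).
        apply Rmult_le_reg_l with (INR M); [lra|]. nra.
      * apply Rmult_le_reg_r with (INR (S n)); auto.
        specialize (Hfa (S n)). replace ((4 * (a (S n) / INR (S n)) + C / INR (S n)) * INR (S n))
          with (4 * a (S n) + C) by (field; lra).
        unfold Rdiv. rewrite Rmult_assoc, Rinv_l, Rmult_1_r by lra. lra.
    + replace (Finite (4 * s)) with (Finite (4 * s - 0)) by (f_equal; ring).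
      apply is_lim_seq_minus'; [apply is_lim_seq_const|apply is_lim_seq_const_over_n].
    + replace (Finite (4 * s)) with (Finite (4 * s + 0)) by (f_equal; ring).
      apply is_lim_seq_plus'; [|apply is_lim_seq_const_over_n].
      apply (is_lim_seq_scal_l _ 4 s Hla).
Qed.

(* For c in C_Q(G,N), written via m*c = x_1+..+x_k - xc_1 - .. - xc_l in C_Z(G,N):
   scl(c) = scl(mc)/m, fl(c) = fl(mc)/m, the defining limits exist, and
   4 scl(c) = fl(c). *)
Theorem theorem5p18 (G : Group) (N : G -> Prop) (HN : normal_subgroup G N)
  (c : chain1 G) (Hc : in_CC is_rat N c)
  (m : nat) (xs xcs : list G) (Hm : (0 < m)%nat)
  (Hxs : List.Forall N xs) (Hxcs : List.Forall N xcs)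
  (Hrep : forall h, INR m * c h = int_chain xs xcs h)
  (Hint : in_CC is_int N (int_chain xs xcs)) :
  ex_finite_lim_seq (scl_seq N xs xcs) /\
  ex_finite_lim_seq (fl_seq N xs xcs) /\
  4 * (scl_int N xs xcs / INR m) = fl_int N xs xcs / INR m.
Proof.
  (* [A n] encodes the n-th power chain as signed letters, [zs] as loops whose n-th powers are the
     values of these letters. *)
  set (A := fun n => map (fun x => (true, gpow x n)) xs ++ map (fun x => (false, gpow x n)) xcs).
  set (zs := xs ++ map ginv xcs).
  assert (Hzs : Forall N zs).
  { apply Forall_app. split; auto. rewrite Forall_map. revert Hxcs. apply Forall_impl.
    apply (ns_inv _ _ HN). }
  assert (HA : forall n, Forall (fun a => N (snd a)) (A n)).
  { intros n. apply Forall_app. rewrite !Forall_map. split; [revert Hxs|revert Hxcs];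
      apply Forall_impl; intros x; now apply gpow_N. }
  assert (HAz : forall n, map lval (A n) = map (fun z => gpow z n) zs).
  { intros n. unfold A, zs. rewrite !map_app, !map_map. f_equal. apply map_ext.
    intros x. unfold lval. simpl. now rewrite gpow_inv. }
  assert (HAc : forall n h, int_chain (map (fun x => gpow x n) xs) (map (fun x => gpow x n) xcs) h
    = edge_sum (A n) h).
  { intros n h. unfold int_chain, A. rewrite !map_map. clear.
    induction xs as [|x l IH]; simpl; [|rewrite IH; lra].
    induction xcs as [|x l IH]; simpl; [|rewrite IH]; lra. }
  assert (HAl : forall n, length (A n) = length zs).
  { intros n. rewrite <- (length_map lval), HAz. apply length_map. }
  (* The integral boundary fills the chain itself; n copies merged by handles fill its n-th powers.
     Hence no infimum below is over an empty set. *)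
  assert (HFill : forall n, exists K, Fill N (map (fun z => gpow z n) zs) K).
  { destruct Hint as [_ (L & HL1 & HL2 & HL3)].
    destruct (triangles_of_int N L HL1 HL2) as (T & HT & HTb & _).
    destruct (Fill_of_triangles N HN T (A 1%nat)) as (K & HK & _); auto.
    - assert (H1 : forall l : list G, map (fun x => gpow x 1) l = l).
      { intros l. rewrite <- (map_id l) at 2. apply map_ext. intros x. apply gmul_1r. }
      intros h. now rewrite HTb, HL3, <- HAc, !H1.
    - intros n. rewrite HAz in HK.
      assert (HR : exists K', Fill N (concat (repeat (map (fun z => gpow z 1) zs) n)) K').
      { induction n as [|n (K' & IH)]; [exists 0%nat; apply Fill_nil|].
        exists (K + K')%nat. simpl. now apply Fill_app. }
      destruct HR as (K' & HK'). apply Fill_pow_repeat in HK'; auto.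
      rewrite Nat.mul_1_l in HK'. eauto. }
  set (a := fun n => cl_chain N (map (fun z => gpow z n) zs)).
  set (f := fun n => normp N (int_chain (map (fun x => gpow x n) xs) (map (fun x => gpow x n) xcs))).
  assert (Ha : forall n, exists K, a n = INR K /\ Fill N (map (fun z => gpow z n) zs) K /\
    forall K', Fill N (map (fun z => gpow z n) zs) K' -> (K <= K')%nat).
  { intros n. destruct (HFill n) as (K & HK). apply cl_chain_spec with K; auto.
    rewrite Forall_map. revert Hzs. apply Forall_impl. intros z. now apply gpow_N. }
  set (k := INR (length zs)). assert (Hk : 0 <= k) by apply pos_INR.
  assert (Hf : forall n, f n <= 4 * a n + 5 * k + 2 /\ fills N (edge_sum (A n)) (f n + 1)).
  { intros n. destruct (Ha n) as (K & -> & HK & _). rewrite <- HAz in HK.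
    apply Fill_fills in HK; auto. rewrite HAl in HK.
    destruct (normp_spec N _ _ HK) as [H1 H2]. unfold f.
    replace (normp N (int_chain _ _)) with (normp N (edge_sum (A n))); [now split|].
    unfold normp. f_equal. apply Glb_Rbar_eqset. intros r.
    split; intros (L & HL1 & HL2 & HL3 & HL4); exists L; repeat split; auto; intros h;
      now rewrite HL3, HAc. }
  (* One constant serves all errors: k in subadditivity, 5k + 2 above, and below 4k for merging
     copies, k for caps, 1 for the infimum and 1 for rounding. *)
  destruct (quasi_proportional_limits a f (5 * k + 2)) as (s & Hsa & Hsf).
  - intros n. destruct (Ha n) as (K & -> & _). apply pos_INR.
  - lra.
  - intros n n'. destruct (Ha n) as (K & -> & HK & _), (Ha n') as (K' & -> & HK' & _).
    destruct (Ha (n + n')%nat) as (K2 & -> & _ & Hmin).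
    pose proof (Fill_app N _ _ _ _ HK HK') as H. rewrite <- (app_nil_r (map _ zs ++ _)), <- app_assoc in H.
    apply Fill_pow_add in H; auto. rewrite app_nil_r in H. apply Hmin, le_INR in H.
    rewrite !plus_INR in H. fold k in H. lra.
  - intros n. destruct (Hf n). lra.
  - intros n. destruct (Hf n) as [_ (L & HL1 & HL2 & HL3)].
    destruct (integral_filling N L (A n) HL1 HL2) as (M & T & HM & HT & HTb & HTl).
    exists M. split; auto.
    (* M times the n-th power chain is bounded as M separate copies, then merged into the nM-th
       powers. *)
    destruct (Fill_of_triangles N HN T (concat (repeat (A n) M))) as (K & HK & HKT); auto.
    + clear - HA. induction M as [|M IH]; simpl; auto. apply Forall_app. auto.
    + intros h. rewrite HTb. clear. induction M as [|M IH]; [simpl; lra|].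
      rewrite S_INR. simpl. rewrite edge_sum_app, <- IH. lra.
    + rewrite concat_map, map_repeat, HAz in HK. apply Fill_pow_repeat in HK; auto.
      destruct (Ha (n * M)%nat) as (K2 & -> & _ & Hmin). apply Hmin, le_INR in HK.
      rewrite plus_INR, mult_INR in HK. fold k in HK. apply le_INR in HKT.
      rewrite mult_INR, plus_INR in HKT. replace (INR 4) with 4 in HKT by (simpl; lra).
      replace (length (concat (repeat (A n) M))) with (M * length zs)%nat in HKT.
      2:{ rewrite <- (HAl n). clear. induction M; simpl; auto. rewrite length_app. lia. }
      rewrite mult_INR in HKT. fold k in HKT.
      assert (1 <= INR M) by (apply (le_INR 1); auto). nra.
  - assert (Hscl : is_lim_seq (scl_seq N xs xcs) s) by exact Hsa.
    assert (Hfl : is_lim_seq (fl_seq N xs xcs) (4 * s)%R) by exact Hsf.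
    repeat split.
    + now exists s.
    + now exists (4 * s).
    + unfold scl_int, fl_int. rewrite (is_lim_seq_unique _ _ Hscl), (is_lim_seq_unique _ _ Hfl).
      simpl. unfold Rdiv. ring.
Qed.
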